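(* $\mathbf{ACA}_0$ proves that every $T_3$ CSC space is homeomorphic to a linear order with its order topology.
   Context: All notions are formalized in second order arithmetic. CSC space: a tuple $(X,(U_i)_{i\in\mathbb{N}},k)$ with $X\subseteq\mathbb{N}$, $(U_i)$ a sequence of subsets of $X$ such that every $x\in X$ lies in some $U_i$, and $k:X\times\mathbb{N}\times\mathbb{N}\to\mathbb{N}$ a partial function such that $x\in U_i\cap U_j$ implies $x\in U_{k(x,i,j)}\subseteq U_i\cap U_j$. A set $A\subseteq X$ is open if for all $x\in A$ there is $i$ with $x\in U_i\subseteq A$. $X$ is $T_0$ if for distinct $x,y$ some open set contains exactly one of them; regular if whenever $x\in U_i$ there are open sets $V,W$ with $x\in V\subseteq X\setminus W\subseteq U_i$; $T_3$ if $T_0$ and regular. Order topology on a linear order $(L,<_L)$ with $L\subseteq\mathbb{N}$: the CSC space with basic open sets the intervals $]a,b[=\{l\in L:a<_L l<_L b\}$, $a,b\in L\cup\{-\infty,+\infty\}$, and $k(z,(a,b),(x,y))=(\max\{a,x\},\min\{b,y\})$. Over $\mathbf{ACA}_0$ homeomorphisms (continuous bijections with continuous inverse, with respect to the bases) are not distinguished from effective homeomorphisms, since the functions witnessing pointwise continuity are arithmetically definable. *)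

(* Defs.v *)
From Stdlib Require Import List.

(** Syntax of second order arithmetic: two sorts of variables, numbers and
    sets, each with its own de Bruijn indices.  The logic is classical, so
    falsity, implication and the two universal quantifiers are primitive and
    the rest is defined from them.
    Equality is primitive between numbers only. *)

Inductive term : Type :=
| tvar (n : nat)
| tzero
| tone
| tadd (s t : term)
| tmul (s t : term).

Inductive form : Type :=
| fbot
| feq (s t : term)
| flt (s t : term)
| fmem (t : term) (X : nat)
| fimp (A B : form)
| fall (A : form)    (* number quantifier *)
| fall2 (A : form).  (* set quantifier *)

Definition fnot (A : form) : form := fimp A fbot.
Definition fconj (A B : form) : form := fnot (fimp A (fnot B)).
Definition fdisj (A B : form) : form := fimp (fnot A) B.
Definition fiff (A B : form) : form := fconj (fimp A B) (fimp B A).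
Definition fex (A : form) : form := fnot (fall (fnot A)).
Definition fex2 (A : form) : form := fnot (fall2 (fnot A)).

Fixpoint arithmetical (A : form) : Prop :=
  match A with
  | fbot | feq _ _ | flt _ _ | fmem _ _ => True
  | fimp A B => arithmetical A /\ arithmetical B
  | fall A => arithmetical A
  | fall2 _ => False
  end.

Fixpoint tsubst (f : nat -> term) (t : term) : term :=
  match t with
  | tvar n => f n
  | tzero => tzero
  | tone => tone
  | tadd s t => tadd (tsubst f s) (tsubst f t)
  | tmul s t => tmul (tsubst f s) (tsubst f t)
  end.

Definition scons {T : Type} (a : T) (f : nat -> T) (n : nat) : T :=
  match n with O => a | S m => f m end.

Definition tshift (n : nat) : term := tvar (S n).

(* Simultaneous substitution, [f] on number variables, [g] on set variables. *)
Fixpoint subst (f : nat -> term) (g : nat -> nat) (A : form) : form :=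
  match A with
  | fbot => fbot
  | feq s t => feq (tsubst f s) (tsubst f t)
  | flt s t => flt (tsubst f s) (tsubst f t)
  | fmem t X => fmem (tsubst f t) (g X)
  | fimp A B => fimp (subst f g A) (subst f g B)
  | fall A => fall (subst (scons (tvar 0) (fun n => tsubst tshift (f n))) g A)
  | fall2 A => fall2 (subst f (scons 0 (fun X => S (g X))) A)
  end.

Definition shift (A : form) : form := subst tshift (fun X => X) A.
Definition shift2 (A : form) : form := subst tvar S A.
Definition inst (t : term) (A : form) : form :=
  subst (scons t tvar) (fun X => X) A.
Definition inst2 (Y : nat) (A : form) : form :=
  subst tvar (scons Y (fun X => X)) A.

(** Classical two-sorted natural deduction with equality.  The members of [T]
    are axioms in the usual sense that their free variables are read
    universally: the generalisation rules shift the hypotheses [G] but put no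
    condition on [T]. *)

Inductive derives (T : form -> Prop) : list form -> form -> Prop :=
| d_ax G A : T A -> derives T G A
| d_hyp G A : In A G -> derives T G A
| d_impI G A B : derives T (A :: G) B -> derives T G (fimp A B)
| d_impE G A B : derives T G (fimp A B) -> derives T G A -> derives T G B
| d_raa G A : derives T (fnot A :: G) fbot -> derives T G A
| d_allI G A : derives T (map shift G) A -> derives T G (fall A)
| d_allE G A t : derives T G (fall A) -> derives T G (inst t A)
| d_all2I G A : derives T (map shift2 G) A -> derives T G (fall2 A)
| d_all2E G A Y : derives T G (fall2 A) -> derives T G (inst2 Y A)
| d_eqI G t : derives T G (feq t t)
| d_eqE G A s t :
    derives T G (feq s t) -> derives T G (inst s A) -> derives T G (inst t A).

Definition proves (T : form -> Prop) (A : form) : Prop := derives T nil A.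

(** A formula template maps the numbers of enclosing number quantifiers and of
    enclosing set quantifiers to a formula.  A variable bound when [n]
    quantifiers of its sort were already open has index [m - S n] at depth [m];
    so Rocq binders can stand for the variables of the object language. *)

Definition ntm : Type := nat -> term.
Definition svar : Type := nat -> nat.
Definition fm : Type := nat -> nat -> form.

Definition close (A : fm) : form := A 0 0.

Definition n_zero : ntm := fun _ => tzero.
Definition n_one : ntm := fun _ => tone.
Definition nadd (s t : ntm) : ntm := fun n => tadd (s n) (t n).
Definition nmul (s t : ntm) : ntm := fun n => tmul (s n) (t n).

Definition meq (s t : ntm) : fm := fun n _ => feq (s n) (t n).
Definition mlt (s t : ntm) : fm := fun n _ => flt (s n) (t n).
Definition mmem (t : ntm) (X : svar) : fm := fun n k => fmem (t n) (X k).
Definition mnot (A : fm) : fm := fun n k => fnot (A n k).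
Definition mimp (A B : fm) : fm := fun n k => fimp (A n k) (B n k).
Definition mand (A B : fm) : fm := fun n k => fconj (A n k) (B n k).
Definition mor (A B : fm) : fm := fun n k => fdisj (A n k) (B n k).
Definition miff (A B : fm) : fm := fun n k => fiff (A n k) (B n k).
Definition mall (F : ntm -> fm) : fm :=
  fun n k => fall (F (fun m => tvar (m - S n)) (S n) k).
Definition mex (F : ntm -> fm) : fm :=
  fun n k => fex (F (fun m => tvar (m - S n)) (S n) k).
Definition mall2 (F : svar -> fm) : fm :=
  fun n k => fall2 (F (fun m => m - S k) n (S k)).
Definition mex2 (F : svar -> fm) : fm :=
  fun n k => fex2 (F (fun m => m - S k) n (S k)).

Declare Scope fm_scope.
Delimit Scope fm_scope with fm.
Bind Scope fm_scope with fm.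
Bind Scope fm_scope with ntm.

Notation "0" := n_zero : fm_scope.
Notation "1" := n_one : fm_scope.
Notation "s + t" := (nadd s t) : fm_scope.
Notation "s * t" := (nmul s t) : fm_scope.
Notation "s == t" := (meq s t) (at level 70, no associativity) : fm_scope.
Notation "s < t" := (mlt s t) : fm_scope.
Notation "t ∈ X" := (mmem t X) (at level 70, no associativity) : fm_scope.
Notation "¬ A" := (mnot A) (at level 75, right associativity) : fm_scope.
Notation "A ∧ B" := (mand A B) (at level 80, right associativity) : fm_scope.
Notation "A ∨ B" := (mor A B) (at level 85, right associativity) : fm_scope.
Notation "A ⇒ B" := (mimp A B) (at level 90, right associativity) : fm_scope.
Notation "A ⇔ B" := (miff A B) (at level 95, no associativity) : fm_scope.
Notation "∀ x .. y , A" := (mall (fun x => .. (mall (fun y => A%fm)) ..))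
  (at level 200, x binder, y binder, right associativity) : fm_scope.
Notation "∃ x .. y , A" := (mex (fun x => .. (mex (fun y => A%fm)) ..))
  (at level 200, x binder, y binder, right associativity) : fm_scope.
Notation "∀² X .. Y , A" := (mall2 (fun X => .. (mall2 (fun Y => A%fm)) ..))
  (at level 200, X binder, Y binder, right associativity) : fm_scope.
Notation "∃² X .. Y , A" := (mex2 (fun X => .. (mex2 (fun Y => A%fm)) ..))
  (at level 200, X binder, Y binder, right associativity) : fm_scope.

(** The axioms are those of Simpson, _Subsystems of Second Order Arithmetic_,
    I.2-I.3. *)

Inductive ACA0 : form -> Prop :=
| aca_succ_neq_0 : ACA0 (close (∀ m, ¬ m + 1 == 0))
| aca_succ_inj : ACA0 (close (∀ m n, m + 1 == n + 1 ⇒ m == n))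
| aca_add_0 : ACA0 (close (∀ m, m + 0 == m))
| aca_add_succ : ACA0 (close (∀ m n, m + (n + 1) == (m + n) + 1))
| aca_mul_0 : ACA0 (close (∀ m, m * 0 == 0))
| aca_mul_succ : ACA0 (close (∀ m n, m * (n + 1) == (m * n) + m))
| aca_lt_0 : ACA0 (close (∀ m, ¬ m < 0))
| aca_lt_succ : ACA0 (close (∀ m n, m < n + 1 ⇔ (m < n ∨ m == n)))
| aca_induction :
    ACA0 (close (∀² X, (0 ∈ X ∧ (∀ n, n ∈ X ⇒ n + 1 ∈ X)) ⇒ ∀ n, n ∈ X))
(* Arithmetical comprehension, with number and set parameters: number variable
   0 of [A] is the element, and [shift2] makes the comprehended set not occur
   in [A]. *)
| aca_comprehension A :
    arithmetical A ->
    ACA0 (fex2 (fall (fiff (fmem (tvar 0) 0) (shift2 A)))).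

(* Simpson's pairing function (a + b)^2 + a. *)
Definition npair (a b : ntm) : ntm := ((a + b) * (a + b) + a)%fm.

(* A sequence of sets is the set of the pairs (i, x) with x in the i-th set. *)
Definition mem_seq (x : ntm) (U : svar) (i : ntm) : fm := (npair i x ∈ U)%fm.

Notation "x '∈_[' U ',' i ]" := (mem_seq x U i)
  (at level 70, no associativity, U at level 69, i at level 69) : fm_scope.

(* [k] is a set of codes of quadruples (x, i, j, n), meaning k(x,i,j) = n. *)
Definition quad (x i j n : ntm) : ntm := npair (npair (npair x i) j) n.

Definition CSC (X U k : svar) : fm :=
  ((∀ i x, x ∈_[U, i] ⇒ x ∈ X)
   ∧ (∀ x, x ∈ X ⇒ ∃ i, x ∈_[U, i])
   ∧ (∀ z, z ∈ k ⇒ ∃ x i j n, x ∈ X ∧ z == quad x i j n)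
   ∧ (∀ x i j m n, quad x i j m ∈ k ⇒ quad x i j n ∈ k ⇒ m == n)
   ∧ (∀ x i j, x ∈_[U, i] ⇒ x ∈_[U, j] ⇒
        ∃ n, quad x i j n ∈ k ∧ x ∈_[U, n]
             ∧ ∀ y, y ∈_[U, n] ⇒ y ∈_[U, i] ∧ y ∈_[U, j]))%fm.

Definition is_open (X U A : svar) : fm :=
  ((∀ x, x ∈ A ⇒ x ∈ X)
   ∧ (∀ x, x ∈ A ⇒ ∃ i, x ∈_[U, i] ∧ ∀ y, y ∈_[U, i] ⇒ y ∈ A))%fm.

Definition T0 (X U : svar) : fm :=
  (∀ x y, x ∈ X ⇒ y ∈ X ⇒ ¬ x == y ⇒
     ∃² A, is_open X U A ∧ ((x ∈ A ∧ ¬ y ∈ A) ∨ (¬ x ∈ A ∧ y ∈ A)))%fm.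

Definition regular (X U : svar) : fm :=
  (∀ x i, x ∈_[U, i] ⇒
     ∃² V W, is_open X U V ∧ is_open X U W ∧ x ∈ V
             ∧ (∀ y, y ∈ V ⇒ y ∈ X ∧ ¬ y ∈ W)
             ∧ (∀ y, (y ∈ X ∧ ¬ y ∈ W) ⇒ y ∈_[U, i]))%fm.

Definition T3 (X U : svar) : fm := (T0 X U ∧ regular X U)%fm.

(* [R] is the strict order relation on [L]. *)
Definition linear_order (L R : svar) : fm :=
  ((∀ z, z ∈ R ⇒ ∃ a b, a ∈ L ∧ b ∈ L ∧ z == npair a b)
   ∧ (∀ a, ¬ npair a a ∈ R)
   ∧ (∀ a b c, npair a b ∈ R ⇒ npair b c ∈ R ⇒ npair a c ∈ R)
   ∧ (∀ a b, a ∈ L ⇒ b ∈ L ⇒ npair a b ∈ R ∨ a == b ∨ npair b a ∈ R))%fm.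

(* Elements of L ∪ {-∞, +∞} are coded by numbers: 0 is -∞, 1 is +∞, and
   l + 2 is the element l of L. *)
Definition minfty : ntm := 0%fm.
Definition pinfty : ntm := 1%fm.
Definition emb (l : ntm) : ntm := (l + 1 + 1)%fm.

Definition ext (L : svar) (a : ntm) : fm :=
  (a == minfty ∨ a == pinfty ∨ ∃ l, l ∈ L ∧ a == emb l)%fm.

Definition ext_lt (R : svar) (a b : ntm) : fm :=
  ((a == minfty ∧ ¬ b == minfty)
   ∨ (¬ a == pinfty ∧ b == pinfty)
   ∨ (∃ l m, a == emb l ∧ b == emb m ∧ npair l m ∈ R))%fm.

Definition is_max (R : svar) (a b c : ntm) : fm :=
  ((ext_lt R a b ∧ c == b) ∨ (¬ ext_lt R a b ∧ c == a))%fm.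

Definition is_min (R : svar) (a b c : ntm) : fm :=
  ((ext_lt R a b ∧ c == a) ∨ (¬ ext_lt R a b ∧ c == b))%fm.

(* (L, V, h) is the order topology of (L, R).  The interval ]a, b[ has index
   [npair a b]; a number that is not such an index gives the empty set. *)
Definition order_topology (L R V h : svar) : fm :=
  ((∀ z, z ∈ V ⇔
      ∃ a b l, ext L a ∧ ext L b ∧ l ∈ L
               ∧ ext_lt R a (emb l) ∧ ext_lt R (emb l) b
               ∧ z == npair (npair a b) l)
   ∧ (∀ w, w ∈ h ⇔
      ∃ z a b x y c d, z ∈ L ∧ ext L a ∧ ext L b ∧ ext L x ∧ ext L y
               ∧ is_max R a x c ∧ is_min R b y d
               ∧ w == quad z (npair a b) (npair x y) (npair c d)))%fm.

Definition function (f X Y : svar) : fm :=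
  ((∀ z, z ∈ f ⇒ ∃ x y, x ∈ X ∧ y ∈ Y ∧ z == npair x y)
   ∧ (∀ x, x ∈ X ⇒ ∃ y, npair x y ∈ f)
   ∧ (∀ x y z, npair x y ∈ f ⇒ npair x z ∈ f ⇒ y == z))%fm.

Definition bijection (f X Y : svar) : fm :=
  (function f X Y
   ∧ (∀ x y z, npair x z ∈ f ⇒ npair y z ∈ f ⇒ x == y)
   ∧ (∀ y, y ∈ Y ⇒ ∃ x, npair x y ∈ f))%fm.

(* Pointwise continuity with respect to the bases; no function choosing [i]
   from [x] and [j] is required. *)
Definition continuous (f U V : svar) : fm :=
  (∀ x y j, npair x y ∈ f ⇒ y ∈_[V, j] ⇒
     ∃ i, x ∈_[U, i]
          ∧ ∀ u v, u ∈_[U, i] ⇒ npair u v ∈ f ⇒ v ∈_[V, j])%fm.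

Definition inverse (f g : svar) : fm :=
  (∀ x y, npair x y ∈ f ⇔ npair y x ∈ g)%fm.

Definition homeomorphic (X U Y V : svar) : fm :=
  (∃² f g, bijection f X Y ∧ function g Y X ∧ inverse f g
           ∧ continuous f U V ∧ continuous g V U)%fm.

(* Main.v *)
From Stdlib Require Import List Arith Lia Cantor Ring.
From Stdlib Require Import Classical ClassicalEpsilon.
From Stdlib Require Import FunctionalExtensionality PropExtensionality ProofIrrelevance.
Require Import Defs.
Import ListNotations.

(** By Gödel's completeness theorem it suffices to argue in an arbitrary model
    of ACA0, possibly nonstandard, where comprehension and induction hold for
    the predicates definable by arithmetical formulas with parameters.

    A countable regular T0 space has a base of clopen sets [C e].  To separate
    [x] from the complement of [U i], put the points one after the other on
    one of two sides, each with a basic neighbourhood whose closure misses the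
    closures of the finitely many neighbourhoods on the other side.

    The sets [C e] cut the space into a binary tree of clopen cells; the cell
    of [x] at level [n] consists of the points lying in the same [C e], [e < n],
    as [x].  Order each pair of sibling cells so that the least point [mu] (as
    a number) of every left cell is its first point and that of every right
    cell its last point.  Since the least point of a cell is also that of the
    half containing it, this means that a half lies on the same side as its
    parent iff it contains the least point of the parent: the order is a Gray
    code, and the side of a cell is the parity of the number of times the
    least point has changed on the way down to it.  Now every cell is convex
    and has both a first and a last point, so the cells, which are
    neighbourhoods for the original topology, contain intervals around their
    points, and the order topology is the given one. *)

(** * Substitution *)

Definition up (f : nat -> term) : nat -> term :=
  scons (tvar 0) (fun n => tsubst tshift (f n)).

Definition up2 (g : nat -> nat) : nat -> nat := scons 0 (fun X => S (g X)).

Lemma tsubst_comp f g t :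
  tsubst f (tsubst g t) = tsubst (fun n => tsubst f (g n)) t.
Proof. induction t; simpl; congruence. Qed.

Lemma tsubst_id t : tsubst tvar t = t.
Proof. induction t; simpl; congruence. Qed.

Lemma up_comp f g :
  (fun n => tsubst (up f) (up g n)) = up (fun n => tsubst f (g n)).
Proof.
  apply functional_extensionality; intros [|n]; simpl; auto.
  rewrite !tsubst_comp; reflexivity.
Qed.

Lemma up2_comp f g : (fun n => up2 f (up2 g n)) = up2 (fun n => f (g n)).
Proof. apply functional_extensionality; intros [|n]; reflexivity. Qed.

Lemma subst_comp A : forall f g f' g',
  subst f g (subst f' g' A) =
  subst (fun n => tsubst f (f' n)) (fun X => g (g' X)) A.
Proof.
  induction A; intros; simpl; rewrite ?tsubst_comp, ?IHA1, ?IHA2, ?IHA; auto.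
  - do 2 f_equal; apply up_comp.
  - do 2 f_equal; apply up2_comp.
Qed.

Lemma up_id : up tvar = tvar.
Proof. apply functional_extensionality; intros [|n]; reflexivity. Qed.

Lemma up2_id : up2 (fun X => X) = (fun X => X).
Proof. apply functional_extensionality; intros [|n]; reflexivity. Qed.

Lemma subst_id A : subst tvar (fun X => X) A = A.
Proof.
  induction A; simpl; rewrite ?tsubst_id; try congruence.
  - f_equal; rewrite <- IHA at 2; f_equal; apply up_id.
  - f_equal; rewrite <- IHA at 2; f_equal; apply up2_id.
Qed.

Lemma inst_subst_up f g t A :
  inst t (subst (up f) g A) = subst (scons t f) g A.
Proof.
  unfold inst; rewrite subst_comp; f_equal.
  apply functional_extensionality; intros [|n]; simpl; auto.
  rewrite tsubst_comp; apply tsubst_id.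
Qed.

Lemma inst2_subst_up f g Y A :
  inst2 Y (subst f (up2 g) A) = subst f (scons Y g) A.
Proof.
  unfold inst2; rewrite subst_comp; f_equal.
  - apply functional_extensionality; intros n; apply tsubst_id.
  - apply functional_extensionality; intros [|n]; reflexivity.
Qed.

Lemma subst_inst f g t A :
  subst f g (inst t A) = inst (tsubst f t) (subst (up f) g A).
Proof.
  rewrite inst_subst_up; unfold inst; rewrite subst_comp; f_equal.
  apply functional_extensionality; intros [|n]; reflexivity.
Qed.

Lemma subst_inst2 f g Y A :
  subst f g (inst2 Y A) = inst2 (g Y) (subst f (up2 g) A).
Proof.
  rewrite inst2_subst_up; unfold inst2; rewrite subst_comp; f_equal.
  apply functional_extensionality; intros [|n]; reflexivity.
Qed.

Lemma subst_shift f g A : subst (up f) g (shift A) = shift (subst f g A).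
Proof. unfold shift; rewrite !subst_comp; reflexivity. Qed.

Lemma subst_shift2 f g A : subst f (up2 g) (shift2 A) = shift2 (subst f g A).
Proof.
  unfold shift2; rewrite !subst_comp; f_equal.
  apply functional_extensionality; intros n; simpl; symmetry; apply tsubst_id.
Qed.

(* Upper bounds only: indices are not decremented under quantifiers. *)
Fixpoint tbound (t : term) : nat :=
  match t with
  | tvar n => S n
  | tzero | tone => 0
  | tadd s t | tmul s t => max (tbound s) (tbound t)
  end.

Fixpoint nbound (A : form) : nat :=
  match A with
  | fbot => 0
  | feq s t | flt s t => max (tbound s) (tbound t)
  | fmem t _ => tbound t
  | fimp A B => max (nbound A) (nbound B)
  | fall A | fall2 A => nbound A
  end.

Fixpoint sbound (A : form) : nat :=
  match A with
  | fbot | feq _ _ | flt _ _ => 0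
  | fmem _ X => S X
  | fimp A B => max (sbound A) (sbound B)
  | fall A | fall2 A => sbound A
  end.

Lemma tsubst_bound f g t :
  (forall n, n < tbound t -> f n = g n) -> tsubst f t = tsubst g t.
Proof.
  induction t; simpl; intros H; auto; f_equal;
    first [apply IHt1 | apply IHt2]; intros; apply H; lia.
Qed.

Lemma subst_bound A : forall f f' g g',
  (forall n, n < nbound A -> f n = f' n) ->
  (forall n, n < sbound A -> g n = g' n) ->
  subst f g A = subst f' g' A.
Proof.
  induction A; intros f f' g g' Hf Hg; simpl in *.
  - reflexivity.
  - f_equal; apply tsubst_bound; intros; apply Hf; lia.
  - f_equal; apply tsubst_bound; intros; apply Hf; lia.
  - f_equal; [apply tsubst_bound; auto | apply Hg; lia].
  - f_equal; [apply IHA1 | apply IHA2]; intros; first [apply Hf | apply Hg]; lia.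
  - f_equal; apply IHA; auto.
    intros [|n] Hn; simpl; auto. rewrite Hf by lia; reflexivity.
  - f_equal; apply IHA; auto.
    intros [|n] Hn; simpl; auto. rewrite Hg by lia; reflexivity.
Qed.

(** * Completeness of natural deduction *)

Section Derivations.

Context (T : form -> Prop).
Context (T_subst : forall f g A, T A -> T (subst f g A)).

Lemma derives_weaken G A :
  derives T G A -> forall G', incl G G' -> derives T G' A.
Proof.
  induction 1; intros G' HG.
  - now apply d_ax.
  - apply d_hyp; auto.
  - apply d_impI, IHderives; intros B' [|]; simpl; auto.
  - eapply d_impE; eauto.
  - apply d_raa, IHderives; intros B' [|]; simpl; auto.
  - apply d_allI, IHderives, incl_map, HG.
  - apply d_allE; auto.
  - apply d_all2I, IHderives, incl_map, HG.
  - apply d_all2E; auto.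
  - apply d_eqI.
  - eapply d_eqE; eauto.
Qed.

(** The axiom case is what forces the closure of [T] under substitution: axioms may carry free
    variables, which get renamed too. *)
Lemma derives_subst G A :
  derives T G A ->
  forall f g, derives T (map (subst f g) G) (subst f g A).
Proof.
  induction 1; intros f g.
  - apply d_ax; auto.
  - apply d_hyp, in_map; auto.
  - apply d_impI, IHderives.
  - eapply d_impE; [apply IHderives1 | apply IHderives2].
  - apply d_raa, IHderives.
  - apply d_allI. specialize (IHderives (up f) g).
    rewrite map_map in *; erewrite map_ext; [exact IHderives|].
    intros; symmetry; apply subst_shift.
  - rewrite subst_inst; apply d_allE, IHderives.
  - apply d_all2I. specialize (IHderives f (up2 g)).
    rewrite map_map in *; erewrite map_ext; [exact IHderives|].
    intros; symmetry; apply subst_shift2.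
  - rewrite subst_inst2; apply d_all2E, IHderives.
  - apply d_eqI.
  - rewrite subst_inst; eapply d_eqE; [apply IHderives1|].
    rewrite <- subst_inst; apply IHderives2.
Qed.

(** Renaming the fresh variable [n] to 0 and every other [m] to [m + 1] turns the given derivation
    into the premise of [d_allI], since below [n] this renaming is [shift]. *)
Lemma derives_fresh G A n :
  nbound A <= n -> (forall B, In B G -> nbound B <= n) ->
  derives T G (inst (tvar n) A) -> derives T G (fall A).
Proof.
  intros HA HG H. apply d_allI.
  pose (f := fun m => if m =? n then tvar 0 else tvar (S m)).
  assert (E : forall B, nbound B <= n -> subst f (fun X => X) B = shift B).
  { intros B HB; apply subst_bound; auto.
    intros m Hm; unfold f; destruct (Nat.eqb_spec m n); [lia | reflexivity]. }
  apply (derives_subst _ _) with (f := f) (g := fun X => X) in H.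
  rewrite subst_inst in H; simpl in H; unfold f at 2 in H.
  rewrite Nat.eqb_refl, inst_subst_up in H.
  rewrite (subst_bound A _ tvar _ (fun X => X)), subst_id in H; auto.
  - erewrite map_ext_in; [exact H|].
    intros B HB; symmetry; apply E; auto.
  - intros [|m] Hm; simpl; auto.
    unfold f; destruct (Nat.eqb_spec m n); [lia | reflexivity].
Qed.

Lemma derives_fresh2 G A n :
  sbound A <= n -> (forall B, In B G -> sbound B <= n) ->
  derives T G (inst2 n A) -> derives T G (fall2 A).
Proof.
  intros HA HG H. apply d_all2I.
  pose (g := fun m => if m =? n then 0 else S m).
  assert (E : forall B, sbound B <= n -> subst tvar g B = shift2 B).
  { intros B HB; apply subst_bound; auto.
    intros m Hm; unfold g; destruct (Nat.eqb_spec m n); [lia | reflexivity]. }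
  apply (derives_subst _ _) with (f := tvar) (g := g) in H.
  rewrite subst_inst2 in H; unfold g at 2 in H.
  rewrite Nat.eqb_refl, inst2_subst_up in H.
  rewrite (subst_bound A _ tvar _ (fun X => X)), subst_id in H; auto.
  - erewrite map_ext_in; [exact H|].
    intros B HB; symmetry; apply E; auto.
  - intros [|m] Hm; simpl; auto.
    unfold g; destruct (Nat.eqb_spec m n); [lia | reflexivity].
Qed.

Lemma derives_exfalso G A : derives T G fbot -> derives T G A.
Proof.
  intros H; apply d_raa; eapply derives_weaken; eauto; intros x; simpl; auto.
Qed.

Lemma derives_cut G A B :
  derives T (A :: G) B -> derives T G A -> derives T G B.
Proof. intros H1 H2; eapply d_impE; [apply d_impI, H1 | exact H2]. Qed.

End Derivations.

(** * Enumeration of formulas *)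

Fixpoint term_code (t : term) : nat :=
  match t with
  | tvar n => to_nat (0, n)
  | tzero => to_nat (1, 0)
  | tone => to_nat (2, 0)
  | tadd s t => to_nat (3, to_nat (term_code s, term_code t))
  | tmul s t => to_nat (4, to_nat (term_code s, term_code t))
  end.

Fixpoint form_code (A : form) : nat :=
  match A with
  | fbot => to_nat (0, 0)
  | feq s t => to_nat (1, to_nat (term_code s, term_code t))
  | flt s t => to_nat (2, to_nat (term_code s, term_code t))
  | fmem t X => to_nat (3, to_nat (term_code t, X))
  | fimp A B => to_nat (4, to_nat (form_code A, form_code B))
  | fall A => to_nat (5, form_code A)
  | fall2 A => to_nat (6, form_code A)
  end.

Lemma to_nat_pair_inj a b c d : to_nat (a, b) = to_nat (c, d) -> a = c /\ b = d.
Proof. intros H; apply to_nat_inj in H; now inversion H. Qed.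

Ltac code_inj :=
  repeat match goal with
  | H : to_nat _ = to_nat _ |- _ => apply to_nat_pair_inj in H as []
  end.

Lemma term_code_inj s : forall t, term_code s = term_code t -> s = t.
Proof.
  induction s; intros []; cbn -[to_nat]; intros; code_inj;
    try discriminate; f_equal; auto.
Qed.

Lemma form_code_inj A : forall B, form_code A = form_code B -> A = B.
Proof.
  induction A; intros []; cbn -[to_nat]; intros; code_inj;
    try discriminate; f_equal; auto using term_code_inj.
Qed.

(** Inverts [form_code] by choice. A number that codes nothing yields an arbitrary formula, which is
    harmless since every formula still occurs. *)
Definition form_enum (n : nat) : form :=
  epsilon (inhabits fbot) (fun A => form_code A = n).

Lemma form_enum_code A : form_enum (form_code A) = A.
Proof.
  apply form_code_inj.
  exact (epsilon_spec (inhabits fbot) (fun B => form_code B = form_code A)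
           (ex_intro _ A eq_refl)).
Qed.

(** * Structures and satisfaction *)

Record structure := {
  num : Type;
  set : Type;
  s0 : num;
  s1 : num;
  sadd : num -> num -> num;
  smul : num -> num -> num;
  slt : num -> num -> Prop;
  smem : num -> set -> Prop }.

Fixpoint eval (S : structure) (r : nat -> num S) (t : term) : num S :=
  match t with
  | tvar n => r n
  | tzero => s0 S
  | tone => s1 S
  | tadd s t => sadd S (eval S r s) (eval S r t)
  | tmul s t => smul S (eval S r s) (eval S r t)
  end.

Fixpoint sat (S : structure) (r : nat -> num S) (q : nat -> set S) (A : form)
  : Prop :=
  match A with
  | fbot => False
  | feq s t => eval S r s = eval S r t
  | flt s t => slt S (eval S r s) (eval S r t)
  | fmem t X => smem S (eval S r t) (q X)
  | fimp A B => sat S r q A -> sat S r q B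
  | fall A => forall x, sat S (scons x r) q A
  | fall2 A => forall X, sat S r (scons X q) A
  end.

(** * Henkin completion *)

Section Henkin.

Context (T : form -> Prop).
Context (T_subst : forall f g A, T A -> T (subst f g A)).
Context (A0 : form).
Context (A0_unprovable : ~ derives T [fnot A0] fbot).

Definition consistent (G : list form) : Prop := ~ derives T G fbot.

Definition ctx_nbound (G : list form) : nat := list_max (map nbound G).
Definition ctx_sbound (G : list form) : nat := list_max (map sbound G).

(** A rejected universal formula leaves a counterexample at a fresh variable, so that refuted
    quantifiers have witnesses. *)
Definition henkin_step (G : list form) (B : form) : list form :=
  if excluded_middle_informative (consistent (B :: G)) then B :: G
  else match B with
  | fall C => fnot (inst (tvar (max (nbound C) (ctx_nbound G))) C) :: G
  | fall2 C => fnot (inst2 (max (sbound C) (ctx_sbound G)) C) :: G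
  | _ => G
  end.

Fixpoint henkin (n : nat) : list form :=
  match n with
  | O => [fnot A0]
  | S n => henkin_step (henkin n) (form_enum n)
  end.

Lemma in_le_list_max (h : form -> nat) G B :
  In B G -> h B <= list_max (map h G).
Proof.
  intros H.
  assert (E := proj1 (list_max_le (map h G) _) (Nat.le_refl _)).
  rewrite Forall_forall in E; apply E, in_map, H.
Qed.

(** If the counterexample could not be added, [G] would prove the instance at the fresh variable,
    hence the universal formula, whose addition was inconsistent. *)
Lemma henkin_step_consistent G B :
  consistent G -> consistent (henkin_step G B).
Proof.
  intros HG; unfold henkin_step.
  destruct (excluded_middle_informative _) as [|N]; auto.
  apply NNPP in N.
  destruct B; auto; intros H; apply HG; apply (derives_cut T _ _ _ N).
  - apply derives_fresh with (n := max (nbound B) (ctx_nbound G));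
      auto; [apply Nat.le_max_l | | apply d_raa, H].
    intros B' HB'; apply (in_le_list_max nbound) in HB'.
    fold (ctx_nbound G) in HB'; lia.
  - apply derives_fresh2 with (n := max (sbound B) (ctx_sbound G));
      auto; [apply Nat.le_max_l | | apply d_raa, H].
    intros B' HB'; apply (in_le_list_max sbound) in HB'.
    fold (ctx_sbound G) in HB'; lia.
Qed.

Lemma henkin_consistent n : consistent (henkin n).
Proof. induction n; simpl; auto. apply henkin_step_consistent; auto. Qed.

Lemma henkin_step_incl G B : incl G (henkin_step G B).
Proof.
  unfold henkin_step; destruct (excluded_middle_informative _);
    [|destruct B]; intros x; simpl; auto.
Qed.

Lemma henkin_incl n m : n <= m -> incl (henkin n) (henkin m).
Proof.
  induction 1; [apply incl_refl|].
  eapply incl_tran; [eassumption | apply henkin_step_incl].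
Qed.

Definition Om (A : form) : Prop := exists n, derives T (henkin n) A.

Lemma Om_bot : ~ Om fbot.
Proof. intros [n H]; exact (henkin_consistent n H). Qed.

Lemma Om_derives G A :
  (forall B, In B G -> Om B) -> derives T G A -> Om A.
Proof.
  intros HG H.
  assert (E : exists n, forall B, In B G -> derives T (henkin n) B).
  { clear H; induction G as [|B G IH]; [exists 0; intros B [] |].
    destruct IH as [n Hn]; [intros; apply HG; simpl; auto|].
    destruct (HG B) as [m Hm]; [simpl; auto|].
    exists (max n m); intros B' [<-|H'].
    - eapply derives_weaken; [exact Hm | apply henkin_incl; lia].
    - eapply derives_weaken; [apply Hn, H' | apply henkin_incl; lia]. }
  destruct E as [n Hn]; exists n; revert A H; clear HG.
  induction G as [|B G IH]; intros A H.
  - eapply derives_weaken; [exact H | intros ? []].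
  - eapply d_impE; [apply IH; [intros; apply Hn; simpl; auto | apply d_impI, H]|].
    apply Hn; simpl; auto.
Qed.

Lemma Om_mp A B : Om (fimp A B) -> Om A -> Om B.
Proof.
  intros H1 H2; apply (Om_derives [fimp A B; A]).
  - intros C [<-|[<-|[]]]; auto.
  - apply d_impE with (A := A); apply d_hyp; simpl; auto.
Qed.

Lemma Om_decide A : Om A \/ Om (fnot A).
Proof.
  destruct (classic (consistent (A :: henkin (form_code A)))) as [H|H].
  - left; exists (S (form_code A)); simpl; rewrite form_enum_code.
    unfold henkin_step; destruct (excluded_middle_informative _); [|contradiction].
    apply d_hyp; simpl; auto.
  - right; exists (form_code A); apply d_impI, NNPP, H.
Qed.

Lemma Om_imp A B : Om (fimp A B) <-> (Om A -> Om B).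
Proof.
  split; [apply Om_mp|]; intros H.
  destruct (Om_decide A) as [HA|HA].
  - apply (Om_derives [B]); [intros C [<-|[]]; auto|].
    apply d_impI, d_hyp; simpl; auto.
  - apply (Om_derives [fnot A]); [intros C [<-|[]]; auto|].
    apply d_impI, derives_exfalso, d_impE with (A := A); apply d_hyp; simpl; auto.
Qed.

(** From right to left: had its stage rejected [fall A], the next stage would refute an instance of
    [A]. *)
Lemma Om_all A : Om (fall A) <-> (forall t, Om (inst t A)).
Proof.
  split.
  - intros [n H] t; exists n; apply d_allE, H.
  - intros H; set (n := form_code (fall A)).
    destruct (classic (consistent (fall A :: henkin n))) as [C|C];
      (exists (S n)); simpl; unfold n at 2; rewrite form_enum_code; unfold henkin_step;
      destruct (excluded_middle_informative _); try contradiction.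
    + apply d_hyp; simpl; auto.
    + exfalso; apply Om_bot; eapply Om_mp; [|apply H].
      exists (S n); simpl; unfold n at 2; rewrite form_enum_code; unfold henkin_step.
      destruct (excluded_middle_informative _); [contradiction|].
      apply d_hyp; left; reflexivity.
Qed.

Lemma Om_all2 A : Om (fall2 A) <-> (forall X, Om (inst2 X A)).
Proof.
  split.
  - intros [n H] t; exists n; apply d_all2E, H.
  - intros H; set (n := form_code (fall2 A)).
    destruct (classic (consistent (fall2 A :: henkin n))) as [C|C];
      (exists (S n)); simpl; unfold n at 2; rewrite form_enum_code; unfold henkin_step;
      destruct (excluded_middle_informative _); try contradiction.
    + apply d_hyp; simpl; auto.
    + exfalso; apply Om_bot; eapply Om_mp; [|apply H].
      exists (S n); simpl; unfold n at 2; rewrite form_enum_code; unfold henkin_step.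
      destruct (excluded_middle_informative _); [contradiction|].
      apply d_hyp; left; reflexivity.
Qed.

Lemma Om_eqE A s t : Om (feq s t) -> Om (inst s A) -> Om (inst t A).
Proof.
  intros H1 H2; apply (Om_derives [feq s t; inst s A]).
  - intros B [<-|[<-|[]]]; auto.
  - eapply d_eqE; apply d_hyp; simpl; auto.
Qed.

Lemma Om_refl t : Om (feq t t).
Proof. exists 0; apply d_eqI. Qed.

Lemma Om_sym s t : Om (feq s t) -> Om (feq t s).
Proof.
  intros H; generalize (Om_eqE (feq (tvar 0) (tsubst tshift s)) s t H).
  unfold inst; simpl; rewrite !tsubst_comp, !tsubst_id; intros E.
  apply E, Om_refl.
Qed.

Lemma Om_trans s t u : Om (feq s t) -> Om (feq t u) -> Om (feq s u).
Proof.
  intros H H'; generalize (Om_eqE (feq (tsubst tshift s) (tvar 0)) t u H').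
  unfold inst; simpl; rewrite !tsubst_comp, !tsubst_id; auto.
Qed.

Lemma Om_congr (F : term -> term -> term) s s' t t' :
  (forall f a b, tsubst f (F a b) = F (tsubst f a) (tsubst f b)) ->
  Om (feq s s') -> Om (feq t t') -> Om (feq (F s t) (F s' t')).
Proof.
  intros HF H H'.
  generalize (Om_eqE (feq (tsubst tshift (F s t)) (F (tvar 0) (tsubst tshift t))) s s' H).
  generalize (Om_eqE (feq (tsubst tshift (F s t)) (F (tsubst tshift s') (tvar 0))) t t' H').
  unfold inst; simpl; rewrite !HF, !tsubst_comp; simpl; rewrite !tsubst_id.
  intros E1 E2; apply E1, E2, Om_refl.
Qed.

Lemma Om_lt s s' t t' :
  Om (feq s s') -> Om (feq t t') -> Om (flt s t) -> Om (flt s' t').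
Proof.
  intros H H'.
  generalize (Om_eqE (flt (tvar 0) (tsubst tshift t)) s s' H).
  generalize (Om_eqE (flt (tsubst tshift s') (tvar 0)) t t' H').
  unfold inst; simpl; rewrite !tsubst_comp, !tsubst_id; auto.
Qed.

Lemma Om_mem s s' X : Om (feq s s') -> Om (fmem s X) -> Om (fmem s' X).
Proof. intros H; exact (Om_eqE (fmem (tvar 0) X) s s' H). Qed.

(** * Term model *)

Definition cls (t : term) : term -> Prop := fun s => Om (feq t s).

(** [sat] interprets [feq] by Rocq's equality, so provably equal terms have to be identified. *)
Definition qterm : Type := {P : term -> Prop | exists t, P = cls t}.

Definition mk (t : term) : qterm := exist _ (cls t) (ex_intro _ t eq_refl).

Definition rep (a : qterm) : term :=
  proj1_sig (constructive_indefinite_description _ (proj2_sig a)).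

Lemma mk_rep a : mk (rep a) = a.
Proof.
  unfold rep; destruct (constructive_indefinite_description _ _) as [t Ht]; simpl.
  destruct a as [P HP]; simpl in *; subst P.
  unfold mk; f_equal; apply proof_irrelevance.
Qed.

Lemma mk_eq s t : mk s = mk t <-> Om (feq s t).
Proof.
  split; intros H.
  - apply (f_equal (@proj1_sig _ _)) in H; simpl in H.
    change (cls s t); rewrite H; apply Om_refl.
  - assert (E : cls s = cls t).
    { apply functional_extensionality; intros u; apply propositional_extensionality.
      unfold cls; split; intros H'; eapply Om_trans; eauto using Om_sym. }
    (* The proof component mentions the class, so it is generalised before the class is
       rewritten. *)
    unfold mk; revert H; generalize (ex_intro (fun u => cls s = cls u) s eq_refl).
    rewrite E; intros; f_equal; apply proof_irrelevance.
Qed.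

Lemma rep_mk t : Om (feq (rep (mk t)) t).
Proof. apply mk_eq, mk_rep. Qed.

Definition term_model : structure := {|
  num := qterm;
  set := nat;
  s0 := mk tzero;
  s1 := mk tone;
  sadd a b := mk (tadd (rep a) (rep b));
  smul a b := mk (tmul (rep a) (rep b));
  slt a b := Om (flt (rep a) (rep b));
  smem a X := Om (fmem (rep a) X) |}.

Lemma eval_term_model f t :
  eval term_model (fun n => mk (f n)) t = mk (tsubst f t).
Proof.
  induction t; simpl; auto; rewrite IHt1, IHt2; apply mk_eq; apply Om_congr;
    auto using rep_mk.
Qed.

(** The truth lemma. Sets of the model are set variables, so the set quantifier matches [Om_all2]
    directly; for numbers a representative term is chosen. *)
Lemma sat_term_model A : forall f g,
  sat term_model (fun n => mk (f n)) g A <-> Om (subst f g A).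
Proof.
  induction A; intros f g; simpl.
  - split; [tauto | apply Om_bot].
  - rewrite !eval_term_model; apply mk_eq.
  - rewrite !eval_term_model; split; apply Om_lt; auto using rep_mk, Om_sym.
  - rewrite !eval_term_model; split; apply Om_mem; auto using rep_mk, Om_sym.
  - rewrite Om_imp, IHA1, IHA2; reflexivity.
  - fold (up f); rewrite Om_all; split; intros H t.
    + rewrite inst_subst_up, <- IHA.
      replace (fun n => mk (scons t f n)) with (scons (mk t) (fun n => mk (f n))); auto.
      apply functional_extensionality; intros [|n]; reflexivity.
    + specialize (H (rep t)); rewrite inst_subst_up, <- IHA in H.
      replace (scons t (fun n => mk (f n))) with (fun n => mk (scons (rep t) f n)); auto.
      apply functional_extensionality; intros [|n]; simpl; auto; apply mk_rep.
  - fold (up2 g); rewrite Om_all2; split; intros H X.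
    + rewrite inst2_subst_up, <- IHA; auto.
    + rewrite IHA, <- inst2_subst_up; auto.
Qed.

Lemma term_model_T A r q : T A -> sat term_model r q A.
Proof.
  intros H; replace r with (fun n => mk (rep (r n))).
  - apply sat_term_model; exists 0; apply d_ax, T_subst, H.
  - apply functional_extensionality; intros; apply mk_rep.
Qed.

Lemma term_model_A0 : ~ sat term_model (fun n => mk (tvar n)) (fun X => X) A0.
Proof.
  intros H; apply sat_term_model in H; rewrite subst_id in H.
  apply Om_bot; eapply Om_mp; [|exact H].
  exists 0; apply d_hyp; simpl; auto.
Qed.

End Henkin.

(** If [A] is not derivable, its negation is consistent by [d_raa], and the term model of the
    completion satisfies [T] but not [A]. *)
Theorem completeness (T : form -> Prop) (A : form) :
  (forall f g B, T B -> T (subst f g B)) ->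
  (forall S : structure,
     (forall B r q, T B -> sat S r q B) -> forall r q, sat S r q A) ->
  proves T A.
Proof.
  intros HT H; apply d_raa; apply NNPP; intros C.
  apply (term_model_A0 T HT A C), H.
  intros; apply term_model_T; auto.
Qed.

Lemma subst_arithmetical A : forall f g,
  arithmetical A -> arithmetical (subst f g A).
Proof. induction A; simpl; firstorder. Qed.

(** All axioms but comprehension are closed; in comprehension the substitution passes under both
    binders and commutes with [shift2]. *)
Lemma ACA0_subst f g A : ACA0 A -> ACA0 (subst f g A).
Proof.
  intros H; destruct H as [| | | | | | | | |B HB]; try (constructor; fail).
  change (subst f g (fex2 (fall (fiff (fmem (tvar 0) 0) (shift2 B)))))
    with (fex2 (fall (fiff (fmem (tvar 0) 0) (subst (up f) (up2 g) (shift2 B))))).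
  rewrite subst_shift2; constructor; apply subst_arithmetical; auto.
Qed.

(** * Tarskian truth with the defined connectives recognised *)

Definition is_bot (A : form) : bool := match A with fbot => true | _ => false end.

(* As a premise such a formula has the shape [fnot _], but it is not the left
   half of a disjunction. *)
Definition is_conj_or_ex (A : form) : bool :=
  match A with
  | fimp _ (fimp _ fbot) | fall (fimp _ fbot) | fall2 (fimp _ fbot) => true
  | _ => false
  end.

(** Under [sat], encoded conjunctions and existentials become nested implications. Reading the
    encodings back lets [cbn] produce the intended statements. *)
Fixpoint holds (S : structure) (r : nat -> num S) (q : nat -> set S) (A : form)
  : Prop :=
  match A with
  | fbot => False
  | feq s t => eval S r s = eval S r t
  | flt s t => slt S (eval S r s) (eval S r t)
  | fmem t X => smem S (eval S r t) (q X)
  | fimp A B =>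
      match A with
      | fimp A1 fbot =>
          if is_conj_or_ex A1 then holds S r q A -> holds S r q B
          else holds S r q A1 \/ holds S r q B
      | fimp A1 (fimp A2 C) =>
          if (is_bot C && is_bot B)%bool then holds S r q A1 /\ holds S r q A2
          else holds S r q A -> holds S r q B
      | fall (fimp A1 C) =>
          if (is_bot C && is_bot B)%bool then exists x, holds S (scons x r) q A1
          else holds S r q A -> holds S r q B
      | fall2 (fimp A1 C) =>
          if (is_bot C && is_bot B)%bool then exists X, holds S r (scons X q) A1
          else holds S r q A -> holds S r q B
      | _ => holds S r q A -> holds S r q B
      end
  | fall A => forall x, holds S (scons x r) q A
  | fall2 A => forall X, holds S r (scons X q) A
  end.

Fixpoint size (A : form) : nat :=
  match A with
  | fimp A B => S (size A + size B)
  | fall A | fall2 A => S (size A)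
  | _ => 0
  end.

(** Induction on [size], because a recognised connective is unfolded several constructors at
    once. *)
Lemma holds_sat S A : forall r q, holds S r q A <-> sat S r q A.
Proof.
  remember (size A) as n eqn:Hn; assert (Hle : size A <= n) by lia; clear Hn.
  revert A Hle; induction n as [|n IH]; intros A Hle r q.
  - destruct A; simpl in *; try lia; tauto.
  - destruct A as [| | | |A B|A|A]; simpl in Hle; try (simpl; tauto).
    2: simpl; split; intros H x; apply IH; auto; lia.
    2: simpl; split; intros H x; apply IH; auto; lia.
    assert (D : (holds S r q A -> holds S r q B) <-> sat S r q (fimp A B)).
    { simpl; rewrite !IH by lia; tauto. }
    assert (E1 : forall A', A = fimp A' fbot ->
              (holds S r q A' \/ holds S r q B) <-> sat S r q (fimp A B)).
    { intros A' ->; simpl in *; rewrite !IH by lia; tauto. }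
    assert (E2 : forall A' B', A = fimp A' (fimp B' fbot) -> B = fbot ->
              (holds S r q A' /\ holds S r q B') <-> sat S r q (fimp A B)).
    { intros A' B' -> ->; simpl in *; rewrite !IH by lia; tauto. }
    assert (E3 : forall A', A = fall (fimp A' fbot) -> B = fbot ->
              (exists x, holds S (scons x r) q A') <-> sat S r q (fimp A B)).
    { intros A' -> ->; simpl in *; split.
      - intros [x H] C; apply (C x), IH; auto; lia.
      - intros C; apply NNPP; intros N; apply C; intros x H.
        apply N; exists x; apply IH; auto; lia. }
    assert (E4 : forall A', A = fall2 (fimp A' fbot) -> B = fbot ->
              (exists X, holds S r (scons X q) A') <-> sat S r q (fimp A B)).
    { intros A' -> ->; simpl in *; split.
      - intros [x H] C; apply (C x), IH; auto; lia.
      - intros C; apply NNPP; intros N; apply C; intros x H.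
        apply N; exists x; apply IH; auto; lia. }
    assert (F : forall C, (is_bot C && is_bot B)%bool = true -> C = fbot /\ B = fbot).
    { intros []; try discriminate; destruct B; try discriminate; auto. }
    clear IH Hle.
    destruct A as [| | | |A1 A2|A|A]; try exact D.
    + destruct A2 as [| | | |A2 A3| |]; try exact D.
      { change (holds S r q (fimp (fimp A1 fbot) B)) with
          (if is_conj_or_ex A1 then holds S r q (fimp A1 fbot) -> holds S r q B
           else holds S r q A1 \/ holds S r q B).
        destruct (is_conj_or_ex A1); [exact D | apply E1; reflexivity]. }
      specialize (F A3); change (holds S r q (fimp (fimp A1 (fimp A2 A3)) B)) with
        (if (is_bot A3 && is_bot B)%bool then holds S r q A1 /\ holds S r q A2
         else holds S r q (fimp A1 (fimp A2 A3)) -> holds S r q B).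
      destruct (andb _ _); [|exact D]; destruct F as [-> ->]; auto.
    + destruct A as [| | | |A1 A2| |]; try exact D.
      specialize (F A2); change (holds S r q (fimp (fall (fimp A1 A2)) B)) with
        (if (is_bot A2 && is_bot B)%bool then exists x, holds S (scons x r) q A1
         else holds S r q (fall (fimp A1 A2)) -> holds S r q B).
      destruct (andb _ _); [|exact D]; destruct F as [-> ->]; auto.
    + destruct A as [| | | |A1 A2| |]; try exact D.
      specialize (F A2); change (holds S r q (fimp (fall2 (fimp A1 A2)) B)) with
        (if (is_bot A2 && is_bot B)%bool then exists X, holds S r (scons X q) A1
         else holds S r q (fall2 (fimp A1 A2)) -> holds S r q B).
      destruct (andb _ _); [|exact D]; destruct F as [-> ->]; auto.
Qed.

Lemma eval_subst S r f t : eval S r (tsubst f t) = eval S (fun n => eval S r (f n)) t.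
Proof. induction t; simpl; congruence. Qed.

Lemma sat_subst S A : forall r q f g,
  sat S r q (subst f g A) <-> sat S (fun n => eval S r (f n)) (fun X => q (g X)) A.
Proof.
  induction A; intros r q f g; simpl; rewrite ?eval_subst, ?IHA1, ?IHA2; try tauto.
  - split; intros H x; specialize (H x); revert H; rewrite IHA;
      replace (fun n => eval S (scons x r) _)
        with (scons x (fun n => eval S r (f n))); auto;
      apply functional_extensionality; intros [|n]; simpl; rewrite ?eval_subst; auto.
  - split; intros H X; specialize (H X); revert H; rewrite IHA;
      replace (fun n => scons X q _) with (scons X (fun n => q (g n))); auto;
      apply functional_extensionality; intros [|n]; reflexivity.
Qed.

Lemma sat_ex2 S r q A : sat S r q (fex2 A) <-> exists X, sat S r (scons X q) A.
Proof.
  simpl; split; [intros H; apply NNPP; firstorder | firstorder].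
Qed.

Lemma sat_iff S r q A B : sat S r q (fiff A B) <-> (sat S r q A <-> sat S r q B).
Proof. simpl; tauto. Qed.

(** Interleaving leaves infinitely many variables to each part: arguments and parameters, or the
    parameters of two formulas. *)
Definition mix {T : Type} (a b : nat -> T) (n : nat) : T :=
  if Nat.even n then a (Nat.div2 n) else b (Nat.div2 n).

Lemma mix_even {T : Type} (a b : nat -> T) n : mix a b (2 * n) = a n.
Proof.
  unfold mix; rewrite Nat.even_mul, Nat.div2_double; reflexivity.
Qed.

Lemma mix_odd {T : Type} (a b : nat -> T) n : mix a b (S (2 * n)) = b n.
Proof.
  unfold mix; rewrite Nat.even_succ, <- Nat.negb_even, Nat.even_mul,
    Nat.div2_succ_double; reflexivity.
Qed.

Definition ren (h k : nat -> nat) : nat -> nat :=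
  mix (fun n => 2 * h n) (fun n => S (2 * k n)).

Lemma mix_ren {T : Type} (a b : nat -> T) h k n :
  mix a b (ren h k n) = mix (fun n => a (h n)) (fun n => b (k n)) n.
Proof.
  unfold ren; unfold mix at 2 3; destruct (Nat.even n);
    auto using mix_even, mix_odd.
Qed.

(** * Models of ACA0 *)

Section Model.

Context (S : structure).
Context (q0 : nat -> set S).
Context (S_ACA0 : forall A r q, ACA0 A -> sat S r q A).

Notation M := (num S).
Declare Scope M_scope.
Bind Scope M_scope with num.
Local Open Scope M_scope.
Notation "0" := (s0 S) : M_scope.
Notation "1" := (s1 S) : M_scope.
Notation "x + y" := (sadd S x y) : M_scope.
Notation "x * y" := (smul S x y) : M_scope.
Notation "x < y" := (slt S x y) : M_scope.
Notation env := (nat -> M).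

(** Arithmetical definability with parameters: the even variables of the
    formula read the arguments, the odd ones number parameters. *)
Definition ar (P : env -> Prop) : Prop :=
  exists A r0 q, arithmetical A /\ forall r, P r <-> sat S (mix r r0) q A.

Definition tail (r : env) : env := fun n => r (Datatypes.S n).

Lemma ar_ext P Q : (forall r, P r <-> Q r) -> ar P -> ar Q.
Proof.
  intros H (A & r0 & q & HA & E); exists A, r0, q; split; auto.
  intros r; rewrite <- H; apply E.
Qed.

Lemma ar_ren P h : ar P -> ar (fun r => P (fun n => r (h n))).
Proof.
  intros (A & r0 & q & HA & E).
  exists (subst (fun n => tvar (ren h (fun n => n) n)) (fun X => X) A), r0, q.
  split; [apply subst_arithmetical, HA|]; intros r; rewrite E, sat_subst; simpl.
  replace (fun n => mix r r0 (ren h (fun n => n) n))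
    with (mix (fun n => r (h n)) r0); [tauto|].
  apply functional_extensionality; intros n; symmetry; apply mix_ren.
Qed.

(** The parameters of the two formulas are interleaved, so that they do not clash. *)
Lemma ar_imp P Q : ar P -> ar Q -> ar (fun r => P r -> Q r).
Proof.
  intros (A & r0 & q & HA & E) (A' & r0' & q' & HA' & E').
  exists (fimp
    (subst (fun n => tvar (ren (fun n => n) (fun n => (2 * n)%nat) n))
       (fun n => (2 * n)%nat) A)
    (subst (fun n => tvar (ren (fun n => n) (fun n => Datatypes.S (2 * n)) n))
       (fun n => Datatypes.S (2 * n)) A')), (mix r0 r0'), (mix q q').
  split; [simpl; auto using subst_arithmetical|].
  intros r; cbn [sat]; rewrite E, E', !sat_subst; cbn [eval].
  replace (fun n => mix r (mix r0 r0') (ren (fun n => n) (fun n => (2 * n)%nat) n))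
    with (mix r r0).
  replace (fun n => mix r (mix r0 r0')
             (ren (fun n => n) (fun n => Datatypes.S (2 * n)) n))
    with (mix r r0').
  replace (fun n => mix q q' (2 * n)) with q.
  replace (fun n => mix q q' (Datatypes.S (2 * n))) with q'.
  - tauto.
  - apply functional_extensionality; intros; rewrite mix_odd; auto.
  - apply functional_extensionality; intros; rewrite mix_even; auto.
  - apply functional_extensionality; intros; rewrite mix_ren.
    f_equal; apply functional_extensionality; intros; rewrite mix_odd; auto.
  - apply functional_extensionality; intros; rewrite mix_ren.
    f_equal; apply functional_extensionality; intros; rewrite mix_even; auto.
Qed.

Lemma ar_all_env P : ar P -> ar (fun r => forall x, P (scons x r)).
Proof.
  intros (A & r0 & q & HA & E).
  (* Argument 0 becomes the variable bound by [fall]; the other arguments and the parameters are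
     numbered after it. *)
  pose (f := mix (fun n => match n with O => O | Datatypes.S n => Datatypes.S (2 * n) end)
               (fun n => Datatypes.S (Datatypes.S (2 * n)))).
  exists (fall (subst (fun n => tvar (f n)) (fun X => X) A)), r0, q.
  split; [apply subst_arithmetical, HA|].
  intros r; simpl.
  assert (F : forall x, (fun n => scons x (mix r r0) (f n)) = mix (scons x r) r0).
  { intros x; apply functional_extensionality; intros n.
    unfold f; unfold mix at 2 3; destruct (Nat.even n).
    - destruct (Nat.div2 n); cbn [scons]; auto using mix_even.
    - cbn [scons]; apply mix_odd. }
  split; intros H x; specialize (H x); revert H; rewrite E, sat_subst;
    cbn [eval]; rewrite F; auto.
Qed.

Lemma ar_all (P : env -> M -> Prop) :
  ar (fun r => P (fun n => r (Datatypes.S n)) (r O)) -> ar (fun r => forall x, P r x).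
Proof. exact (ar_all_env _). Qed.

Lemma ar_sat A q : arithmetical A -> ar (fun r => sat S r q A).
Proof.
  intros HA; exists (subst (fun n => tvar (2 * n)) (fun X => X) A), (fun _ => 0), q.
  split; [apply subst_arithmetical, HA|]; intros r; rewrite sat_subst; cbn [eval].
  replace (fun n => mix r (fun _ => 0) (2 * n)) with r; [tauto|].
  apply functional_extensionality; intros; rewrite mix_even; auto.
Qed.

Lemma ar_bot : ar (fun _ => False).
Proof. exact (ar_sat fbot q0 I). Qed.

Lemma ar_not P : ar P -> ar (fun r => ~ P r).
Proof. intros H; apply (ar_imp _ _ H ar_bot). Qed.

Lemma ar_or P Q : ar P -> ar Q -> ar (fun r => P r \/ Q r).
Proof.
  intros H H'; apply (ar_ext (fun r => ~ P r -> Q r)); [intros; tauto|].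
  apply ar_imp; auto using ar_not.
Qed.

Lemma ar_and P Q : ar P -> ar Q -> ar (fun r => P r /\ Q r).
Proof.
  intros H H'; apply (ar_ext (fun r => ~ (P r -> ~ Q r))); [intros; tauto|].
  auto using ar_not, ar_imp.
Qed.

Lemma ar_iff P Q : ar P -> ar Q -> ar (fun r => P r <-> Q r).
Proof. intros H H'; apply ar_and; apply ar_imp; auto. Qed.

Lemma ar_ex (P : env -> M -> Prop) :
  ar (fun r => P (fun n => r (Datatypes.S n)) (r O)) -> ar (fun r => exists x, P r x).
Proof.
  intros H; apply (ar_ext (fun r => ~ forall x, ~ P r x)).
  - intros r; split; [intros C; apply NNPP; firstorder | firstorder].
  - apply ar_not, ar_all, ar_not, H.
Qed.

Lemma ar_const (P : Prop) : ar (fun _ => P).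
Proof.
  destruct (classic P) as [H|H].
  - apply (ar_ext (fun _ => False -> False)); [tauto | apply ar_imp; apply ar_bot].
  - apply (ar_ext (fun _ => False)); [tauto | apply ar_bot].
Qed.

(** Values are handled through graphs, so that defined functions such as [pr] nest like primitive
    ones. *)
Definition art (t : env -> M) : Prop := ar (fun r => r O = t (tail r)).

Lemma ar_let (P : M -> env -> Prop) t :
  art t -> ar (fun r => P (r O) (fun n => r (Datatypes.S n))) -> ar (fun r => P (t r) r).
Proof.
  intros Ht HP; apply (ar_ext (fun r => exists x, x = t r /\ P x r)).
  - intros r; split; [intros (x & -> & H); exact H | eauto].
  - apply ar_ex, ar_and; auto.
Qed.

Lemma art_weaken t : art t -> art (fun r => t (fun n => r (Datatypes.S n))).
Proof.
  intros H; exact (ar_ren _ (fun n => match n with O => O | Datatypes.S n => Datatypes.S (Datatypes.S n) end) H).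
Qed.

Lemma art_var n : art (fun r => r n).
Proof. exact (ar_sat (feq (tvar 0) (tvar (Datatypes.S n))) q0 I). Qed.

Lemma art_const c : art (fun _ => c).
Proof.
  exists (feq (tvar 0) (tvar 1)), (fun _ => c), q0; split; [exact I|].
  intros r; reflexivity.
Qed.

(** * Automation of definability proofs *)

Class ar1 (P : M -> Prop) : Prop := ar1_ar : ar (fun r => P (r 0%nat)).
Class ar2 (P : M -> M -> Prop) : Prop :=
  ar2_ar : ar (fun r => P (r 0%nat) (r 1%nat)).
Class ar3 (P : M -> M -> M -> Prop) : Prop :=
  ar3_ar : ar (fun r => P (r 0%nat) (r 1%nat) (r 2%nat)).
Class ar4 (P : M -> M -> M -> M -> Prop) : Prop :=
  ar4_ar : ar (fun r => P (r 0%nat) (r 1%nat) (r 2%nat) (r 3%nat)).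

Lemma ar1_app P {HP : ar1 P} t : art t -> ar (fun r => P (t r)).
Proof.
  intros Ht; apply (ar_let (fun x _ => P x) t Ht), HP.
Qed.

Lemma ar2_app P {HP : ar2 P} t u : art t -> art u -> ar (fun r => P (t r) (u r)).
Proof.
  intros Ht Hu; apply (ar_let (fun x r => P x (u r)) t Ht).
  apply (ar_let (fun y r => P (r O) y)); [apply art_weaken, Hu|].
  exact (ar_ren _ (fun n => match n with O => 1%nat | _ => O end) HP).
Qed.

Lemma ar3_app P {HP : ar3 P} t u v :
  art t -> art u -> art v -> ar (fun r => P (t r) (u r) (v r)).
Proof.
  intros Ht Hu Hv; apply (ar_let (fun x r => P x (u r) (v r)) t Ht).
  apply (ar_let (fun y r => P (r O) y _)); [apply art_weaken, Hu|].
  apply (ar_let (fun y r => P (r 1%nat) (r 0%nat) y)); [apply (art_weaken _ (art_weaken _ Hv))|].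
  exact (ar_ren _ (fun n => match n with O => 2%nat | 1%nat => 1%nat | _ => O end) HP).
Qed.

Lemma ar4_app P {HP : ar4 P} t u v w :
  art t -> art u -> art v -> art w -> ar (fun r => P (t r) (u r) (v r) (w r)).
Proof.
  intros Ht Hu Hv Hw; apply (ar_let (fun x r => P x (u r) (v r) (w r)) t Ht).
  apply (ar_let (fun y r => P (r O) y _ _)); [apply art_weaken, Hu|].
  apply (ar_let (fun y r => P (r 1%nat) (r 0%nat) y _)); [apply (art_weaken _ (art_weaken _ Hv))|].
  apply (ar_let (fun y r => P (r 2%nat) (r 1%nat) (r 0%nat) y));
    [apply (art_weaken _ (art_weaken _ (art_weaken _ Hw)))|].
  exact (ar_ren _ (fun n => match n with O => 3%nat | 1%nat => 2%nat | 2%nat => 1%nat | _ => O end) HP).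
Qed.

#[local] Instance ar_eq : ar2 (fun x y => x = y).
Proof. exact (ar_sat (feq (tvar 0) (tvar 1)) q0 I). Qed.

#[local] Instance ar_lt : ar2 (slt S).
Proof. exact (ar_sat (flt (tvar 0) (tvar 1)) q0 I). Qed.

#[local] Instance ar_mem X : ar1 (fun x => smem S x X).
Proof. exact (ar_sat (fmem (tvar 0) 0) (fun _ => X) I). Qed.

Class arf2 (f : M -> M -> M) : Prop := arf2_ar :: ar3 (fun z x y => z = f x y).

Lemma art_app2 f {Hf : arf2 f} t u :
  art t -> art u -> art (fun r => f (t r) (u r)).
Proof.
  intros; apply (ar3_app (fun z x y => z = f x y)); auto using art_weaken, art_var.
Qed.

#[local] Instance arf2_add : arf2 (sadd S).
Proof. exact (ar_sat (feq (tvar 0) (tadd (tvar 1) (tvar 2))) q0 I). Qed.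

#[local] Instance arf2_mul : arf2 (smul S).
Proof. exact (ar_sat (feq (tvar 0) (tmul (tvar 1) (tvar 2))) q0 I). Qed.

Ltac ar_step :=
  cbn beta;
  first
  [ simple apply art_const | simple apply art_var
  | match goal with |- art (fun r => ?f _ _) => simple apply (art_app2 f) end
  | simple apply ar_const
  | simple apply ar_iff
  | simple apply ar_and | simple apply ar_or | simple apply ar_not
  | simple apply ar_imp
  | simple apply ar_all | simple apply ar_ex
  | match goal with |- ar (fun r => _ = _) => simple apply (ar2_app (fun x y => x = y)) end
  | match goal with |- ar (fun r => smem S _ ?X) => simple apply (ar1_app (fun x => smem S x X)) end
  | match goal with
    | |- ar (fun r => ?P _ _ _ _) => simple apply (ar4_app P)
    | |- ar (fun r => ?P _ _ _) => simple apply (ar3_app P)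
    | |- ar (fun r => ?P _ _) => simple apply (ar2_app P)
    | |- ar (fun r => ?P _) => simple apply (ar1_app P)
    end ].

Ltac ar_solve := repeat ar_step.

Ltac ar_def D := unfold arf2, ar1, ar2, ar3, ar4, D; ar_solve.

Lemma comprehension P : ar1 P -> exists X, forall x, smem S x X <-> P x.
Proof.
  intros (A & r0 & q & HA & E).
  (* Every argument reads variable 0, the element of the set; parameter [k] reads variable
     [k + 1]. *)
  pose (B := subst (fun n => tvar (mix (fun _ => 0%nat) Datatypes.S n)) (fun X => X) A).
  assert (HB : arithmetical B) by (apply subst_arithmetical, HA).
  assert (H := S_ACA0 _ r0 q (aca_comprehension B HB)).
  apply sat_ex2 in H; destruct H as [X H]; exists X; intros x.
  specialize (H x); apply sat_iff in H; unfold shift2 in H; rewrite sat_subst in H.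
  rewrite (E (fun _ => x)).
  replace (mix (fun _ => x) r0) with
    (fun n => eval S (scons x r0) (tvar (mix (fun _ => 0%nat) Datatypes.S n))).
  2: { apply functional_extensionality; intros n; unfold mix; simpl.
       destruct (Nat.even n); reflexivity. }
  replace q with (fun Y => q ((fun X => X) Y)) by reflexivity.
  rewrite <- sat_subst; exact H.
Qed.

(** ** Arithmetic *)

Lemma succ_neq_0 m : m + 1 <> 0.
Proof. exact (S_ACA0 _ (fun _ => 0) q0 aca_succ_neq_0 m). Qed.

Lemma succ_inj m n : m + 1 = n + 1 -> m = n.
Proof. exact (S_ACA0 _ (fun _ => 0) q0 aca_succ_inj m n). Qed.

Lemma add_0_r m : m + 0 = m.
Proof. exact (S_ACA0 _ (fun _ => 0) q0 aca_add_0 m). Qed.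

Lemma add_succ_r m n : m + (n + 1) = m + n + 1.
Proof. exact (S_ACA0 _ (fun _ => 0) q0 aca_add_succ m n). Qed.

Lemma mul_0_r m : m * 0 = 0.
Proof. exact (S_ACA0 _ (fun _ => 0) q0 aca_mul_0 m). Qed.

Lemma mul_succ_r m n : m * (n + 1) = m * n + m.
Proof. exact (S_ACA0 _ (fun _ => 0) q0 aca_mul_succ m n). Qed.

Lemma not_lt_0 m : ~ m < 0.
Proof. exact (S_ACA0 _ (fun _ => 0) q0 aca_lt_0 m). Qed.

Lemma lt_succ m n : m < n + 1 <-> m < n \/ m = n.
Proof.
  assert (H := S_ACA0 _ (fun _ => 0) q0 aca_lt_succ); apply holds_sat in H.
  exact (H m n).
Qed.

(** The induction axiom speaks of sets; comprehension supplies the one defined by [P]. *)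
Lemma induction P : ar1 P -> P 0 -> (forall n, P n -> P (n + 1)) -> forall n, P n.
Proof.
  intros HP H0 HS; destruct (comprehension P HP) as [X HX].
  assert (H := S_ACA0 _ (fun _ => 0) q0 aca_induction); apply holds_sat in H.
  intros n; apply HX; revert n; apply (H X); split; [apply HX, H0|].
  intros n; cbn; rewrite !HX; apply HS.
Qed.

Ltac ind n := pattern n; apply induction; [unfold ar1; ar_solve | | ]; clear n.

Lemma add_0_l m : 0 + m = m.
Proof.
  ind m; [apply add_0_r | intros m IH; rewrite add_succ_r, IH; auto].
Qed.

Lemma add_succ_l m n : m + 1 + n = m + n + 1.
Proof.
  ind n; [rewrite !add_0_r; auto | intros n IH; rewrite !add_succ_r, IH; auto].
Qed.

Lemma add_comm m n : m + n = n + m.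
Proof.
  ind n; [rewrite add_0_l, add_0_r; auto|].
  intros n IH; rewrite add_succ_r, add_succ_l, IH; auto.
Qed.

Lemma add_assoc m n p : m + (n + p) = m + n + p.
Proof.
  ind p; [rewrite !add_0_r; auto | intros p IH; rewrite !add_succ_r, IH; auto].
Qed.

Lemma mul_0_l m : 0 * m = 0.
Proof.
  ind m; [apply mul_0_r | intros m IH; rewrite mul_succ_r, IH, add_0_r; auto].
Qed.

Lemma mul_succ_l m n : (m + 1) * n = m * n + n.
Proof.
  ind n; [rewrite !mul_0_r, add_0_r; auto|].
  intros n IH; rewrite !mul_succ_r, IH, !add_succ_r; f_equal.
  rewrite <- !add_assoc, (add_comm n m); auto.
Qed.

Lemma mul_comm m n : m * n = n * m.
Proof.
  ind n; [rewrite mul_0_l, mul_0_r; auto|].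
  intros n IH; rewrite mul_succ_r, mul_succ_l, IH; auto.
Qed.

Lemma mul_add_l m n p : (m + n) * p = m * p + n * p.
Proof.
  ind n; [rewrite mul_0_l, !add_0_r; auto|].
  intros n IH; rewrite add_succ_r, !mul_succ_l, IH, add_assoc; auto.
Qed.

Lemma mul_assoc m n p : m * (n * p) = m * n * p.
Proof.
  ind p; [rewrite !mul_0_r; auto|].
  intros p IH; rewrite !mul_succ_r, <- IH, (mul_comm m (n * p + n)), mul_add_l, !(mul_comm _ m); auto.
Qed.

Lemma mul_1_l m : 1 * m = m.
Proof. rewrite <- (add_0_l 1), mul_succ_l, mul_0_l, add_0_l; auto. Qed.

Lemma M_semiring : semi_ring_theory 0 1 (sadd S) (smul S) eq.
Proof.
  constructor; auto using add_0_l, add_comm, add_assoc, mul_1_l, mul_0_l,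
    mul_comm, mul_assoc, mul_add_l.
Qed.

Add Ring M_ring : M_semiring.

Lemma add_cancel_r x y z : x + z = y + z -> x = y.
Proof.
  ind z; [rewrite !add_0_r; auto|].
  intros z IH; rewrite !add_succ_r; intros H; apply IH, succ_inj, H.
Qed.

Lemma add_cancel_l x y z : z + x = z + y -> x = y.
Proof. rewrite !(add_comm z); apply add_cancel_r. Qed.

Lemma zero_or_succ n : n = 0 \/ exists m, n = m + 1.
Proof. ind n; eauto. Qed.

Lemma add_eq_0 x y : x + y = 0 -> x = 0 /\ y = 0.
Proof.
  intros H; destruct (zero_or_succ y) as [->|[z ->]].
  - rewrite add_0_r in H; auto.
  - rewrite add_succ_r in H; destruct (succ_neq_0 _ H).
Qed.

Lemma zero_neq_one : 0 <> 1.
Proof. intros E; apply (succ_neq_0 0); rewrite add_0_l; auto. Qed.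

Lemma lt_add x y : x < y <-> exists k, y = x + k + 1.
Proof.
  ind y.
  - split; [intros H; destruct (not_lt_0 _ H)|].
    intros [k H]; destruct (succ_neq_0 _ (eq_sym H)).
  - intros y IH; rewrite lt_succ, IH; split.
    + intros [[k ->]| ->]; [exists (k + 1); ring | exists 0; ring].
    + intros [k H]; apply succ_inj in H; subst y.
      destruct (zero_or_succ k) as [->|[z ->]]; [right; ring | left; exists z; ring].
Qed.

Lemma lt_irrefl x : ~ x < x.
Proof.
  intros [k H]%lt_add; apply (succ_neq_0 k), (add_cancel_l _ _ x).
  rewrite add_0_r, add_assoc; auto.
Qed.

Lemma lt_trans x y z : x < y -> y < z -> x < z.
Proof.
  rewrite !lt_add; intros [k ->] [l ->]; exists (k + l + 1); ring.
Qed.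

Lemma lt_trichotomy x y : x < y \/ x = y \/ y < x.
Proof.
  ind x.
  - destruct (zero_or_succ y) as [->|[z ->]]; auto.
    left; apply lt_add; exists z; ring.
  - intros x [H|[->|H]].
    + apply lt_add in H as [k ->].
      destruct (zero_or_succ k) as [->|[z ->]]; [right; left; ring|].
      left; apply lt_add; exists z; ring.
    + right; right; apply lt_succ; auto.
    + right; right; apply lt_succ; auto.
Qed.

Lemma lt_succ_diag x : x < x + 1.
Proof. apply lt_succ; auto. Qed.

Lemma lt_add_l x y : x < x + y + 1.
Proof. apply lt_add; eauto. Qed.

Lemma lt_add_r x y : y < x + y + 1.
Proof. rewrite (add_comm x); apply lt_add_l. Qed.

Lemma lt_succ_succ x y : x + 1 < y + 1 <-> x < y.
Proof.
  rewrite !lt_add; split; intros [k E]; exists k.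
  - apply succ_inj; rewrite E; ring.
  - rewrite E; ring.
Qed.

Lemma not_lt x y : ~ x < y <-> y < x + 1.
Proof.
  rewrite lt_succ; split.
  - destruct (lt_trichotomy x y) as [H|[H|H]]; auto; tauto.
  - intros [H| ->]; [intros H'; apply (lt_irrefl x); eauto using lt_trans | apply lt_irrefl].
Qed.

Lemma strong_induction P :
  ar1 P -> (forall n, (forall m, m < n -> P m) -> P n) -> forall n, P n.
Proof.
  intros HP H n; apply H; revert n.
  apply (induction (fun n => forall m, m < n -> P m)).
  - unfold ar1; ar_solve.
  - intros m Hm; destruct (not_lt_0 _ Hm).
  - intros n IH m [Hm| ->]%lt_succ; auto.
Qed.

Lemma least_number P :
  ar1 P -> (exists n, P n) -> exists n, P n /\ forall m, m < n -> ~ P m.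
Proof.
  intros HP [n Hn]; apply NNPP; intros N; revert n Hn.
  apply (strong_induction (fun n => ~ P n)).
  - unfold ar1; ar_solve.
  - intros n IH Hn; apply N; eauto.
Qed.

Definition pr (a b : M) : M := (a + b) * (a + b) + a.

#[local] Instance arf2_pr : arf2 pr.
Proof. ar_def pr. Qed.

(** [pr a b] is at least the square of [a + b] and below the next square, so it determines first the
    sum and then [a]. *)
Lemma pr_inj a b c d : pr a b = pr c d -> a = c /\ b = d.
Proof.
  assert (L : forall a b c d, a + b < c + d -> pr a b <> pr c d).
  { clear a b c d; intros a b c d [k Hk]%lt_add; unfold pr; rewrite Hk; intros E.
    (* The successor of this number is the excess of [pr c d] over [pr a b] when
       [c + d = a + b + k + 1]. *)
    apply (succ_neq_0 (a + b + b + k * (a + b + a + b) + k * k + k + k + c)).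
    apply (add_cancel_l _ _ ((a + b) * (a + b) + a)); rewrite add_0_r; rewrite E at 2; ring. }
  intros E; destruct (lt_trichotomy (a + b) (c + d)) as [H|[H|H]].
  - destruct (L _ _ _ _ H E).
  - unfold pr in E; rewrite H in E; apply add_cancel_l in E; subst c.
    split; [auto | exact (add_cancel_l _ _ _ H)].
  - destruct (L _ _ _ _ H (eq_sym E)).
Qed.

(** ** Codes of finite sets *)

Definition dv (a b : M) : Prop := exists k, b = a * k.

#[local] Instance ar_dv : ar2 dv.
Proof. ar_def dv. Qed.

(** Coprimality in the form of Euclid's lemma, which makes closure under products immediate. *)
Definition coprime (a b : M) : Prop := forall z, dv a (b * z) -> dv a z.

#[local] Instance ar_coprime : ar2 coprime.
Proof. ar_def coprime. Qed.

Lemma dv_mul_l a b c : dv a b -> dv a (b * c).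
Proof. intros [k ->]; exists (k * c); ring. Qed.

Lemma dv_mul_r a b c : dv a b -> dv a (c * b).
Proof. rewrite mul_comm; apply dv_mul_l. Qed.

Lemma dv_refl a : dv a a.
Proof. exists 1; ring. Qed.

Lemma dv_add_cancel a u v : dv a u -> dv a (u + v) -> dv a v.
Proof.
  intros [s ->] [t E].
  assert (L : s < t \/ exists k, s = t + k).
  { destruct (lt_trichotomy s t) as [H|[->|H]]; auto; right.
    - exists 0; ring.
    - apply lt_add in H as [k ->]; exists (k + 1); ring. }
  destruct L as [[k ->]%lt_add|[k ->]].
  - exists (k + 1); apply (add_cancel_l _ _ (a * s)); rewrite E; ring.
  - assert (Z : a * k + v = 0).
    { apply (add_cancel_l _ _ (a * t)); rewrite add_0_r; etransitivity; [|exact E]; ring. }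
    apply add_eq_0 in Z as [_ ->]; exists 0; ring.
Qed.

Lemma coprime_mul a b c : coprime a b -> coprime a c -> coprime a (b * c).
Proof. intros H H' z; rewrite <- mul_assoc; auto. Qed.

(** [d] plays the role of the factorial of [n]: each induction step multiplies by the new number. *)
Lemma common_multiple n :
  exists d, d <> 0 /\ forall e, e <> 0 -> e < n + 1 -> dv e d.
Proof.
  ind n.
  - exists 1; split; [rewrite <- (add_0_l 1); apply succ_neq_0|].
    intros e He [H|H]%lt_succ; [destruct (not_lt_0 _ H) | contradiction].
  - intros n (d & Hd & H); exists (d * (n + 1)); split.
    + intros E; destruct (zero_or_succ d) as [->|[d' ->]]; auto.
      replace ((d' + 1) * (n + 1)) with (d' * n + d' + n + 1) in E by ring.
      apply (succ_neq_0 _ E).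
    + intros e He [L| ->]%lt_succ; [apply dv_mul_l; auto | apply dv_mul_r, dv_refl].
Qed.

(** The pairwise coprime moduli of Gödel's beta function. *)
Definition md (d i : M) : M := (i + 1) * d + 1.

#[local] Instance arf2_md : arf2 md.
Proof. ar_def md. Qed.

Lemma coprime_md_base d i : coprime (md d i) d.
Proof.
  intros z H; apply (dv_add_cancel _ ((i + 1) * d * z)).
  - replace ((i + 1) * d * z) with ((i + 1) * (d * z)) by ring; apply dv_mul_r, H.
  - exists z; unfold md; ring.
Qed.

(** The two moduli differ by [d] times the distance [e] of [i] and [j]. The factor [d] can be
    cancelled, and so can [e], being a divisor of [d]. *)
Lemma coprime_md n d i j :
  (forall e, e <> 0 -> e < n + 1 -> dv e d) ->
  i < n -> j < n -> i <> j -> coprime (md d i) (md d j).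
Proof.
  intros Hd Hi Hj N z H.
  assert (L : exists e, e <> 0 /\ e < n + 1 /\ dv (md d i) (d * (e * z))).
  { destruct (lt_trichotomy i j) as [L|[L|L]]; [| contradiction |];
      apply lt_add in L as [k ->]; exists (k + 1); (split; [apply succ_neq_0|]).
    - split.
      + apply lt_add in Hj as [l ->]; apply lt_add; exists (i + l + 1); ring.
      + apply (dv_add_cancel _ (md d i * z)); [apply dv_mul_l, dv_refl|].
        replace (md d i * z + d * ((k + 1) * z)) with (md d (i + k + 1) * z)
          by (unfold md; ring); exact H.
    - split.
      + apply lt_add in Hi as [l ->]; apply lt_add; exists (j + l + 1); ring.
      + apply (dv_add_cancel _ (md d j * z)); [exact H|].
        replace (md d j * z + d * ((k + 1) * z)) with (md d (j + k + 1) * z)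
          by (unfold md; ring); apply dv_mul_l, dv_refl. }
  destruct L as (e & He & Le & D); apply coprime_md_base in D.
  destruct (Hd e He Le) as [f E]; apply coprime_md_base.
  replace (d * z) with (f * (e * z)) by (rewrite E; ring); apply dv_mul_r, D.
Qed.

(** Otherwise the modulus would divide 1, yet it exceeds 1 since [d] is not 0. *)
Lemma not_coprime_dv_md d i c :
  d <> 0 -> coprime (md d i) c -> ~ dv (md d i) c.
Proof.
  intros Hd H D.
  assert (D1 : dv (md d i) 1).
  { apply H; replace (c * 1) with c by ring; auto. }
  destruct D1 as [k E].
  destruct (zero_or_succ k) as [->|[l ->]].
  - apply (succ_neq_0 0); rewrite add_0_l, E; ring.
  - destruct (zero_or_succ d) as [->|[d' ->]]; [contradiction|].
    apply (succ_neq_0 (i * (d' + 1) + d' + l * md (d' + 1) i)).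
    apply (add_cancel_l _ _ 1); rewrite add_0_r.
    transitivity (md (d' + 1) i * (l + 1)); [unfold md; ring | auto].
Qed.

(** [c] is the product of the moduli of the members below [n], built factor by factor. The invariant
    keeps the other moduli coprime to [c], as non-divisibility alone need not survive products. *)
Lemma beta_code P n :
  ar1 P -> exists c d, forall i, i < n -> (dv (md d i) c <-> P i).
Proof.
  intros HP; destruct (common_multiple n) as (d & Hd0 & Hd).
  assert (H : forall m, m < n + 1 -> exists c, forall i, i < n ->
     (i < m /\ P i -> dv (md d i) c) /\ (~ (i < m /\ P i) -> coprime (md d i) c)).
  { intros m; ind m.
    - intros _; exists 1; intros i _; split; [intros [H _]; destruct (not_lt_0 _ H)|].
      intros _ z; rewrite mul_1_l; auto.
    - intros m IH Hm.
      destruct IH as [c Hc]; [eauto using lt_trans, lt_succ_diag|].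
      destruct (classic (P m)) as [Pm|Pm].
      + exists (c * md d m); intros i Hi; destruct (Hc i Hi) as [H1 H2]; split.
        * intros [[L| ->]%lt_succ Pi]; [apply dv_mul_l; auto | apply dv_mul_r, dv_refl].
        * intros N; assert (i <> m) by (intros ->; apply N; split; auto using lt_succ_diag).
          apply coprime_mul.
          -- apply H2; intros [L Pi]; apply N; rewrite lt_succ; auto.
          -- apply (coprime_md n); auto.
             apply lt_succ_succ, Hm.
      + exists c; intros i Hi; destruct (Hc i Hi) as [H1 H2]; split.
        * intros [[L| ->]%lt_succ Pi]; [auto | contradiction].
        * intros N; apply H2; intros [L Pi]; apply N; rewrite lt_succ; auto. }
  destruct (H n (lt_succ_diag n)) as [c Hc]; exists c, d; intros i Hi.
  destruct (Hc i Hi) as [H1 H2]; split; [|auto].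
  intros D; apply NNPP; intros N; apply (not_coprime_dv_md d i c); auto.
  apply H2; tauto.
Qed.

(* The bound [n] removes the accidental divisors of [c]. *)
Definition inc (w i : M) : Prop :=
  exists c d n, w = pr (pr c d) n /\ i < n /\ dv (md d i) c.

#[local] Instance ar_inc : ar2 inc.
Proof. ar_def inc. Qed.

Lemma finite_code P n :
  ar1 P -> (forall i, P i -> i < n) -> exists w, forall i, inc w i <-> P i.
Proof.
  intros HP Hn; destruct (beta_code P n HP) as (c & d & H).
  exists (pr (pr c d) n); intros i; split.
  - intros (c' & d' & n' & E & Hi & D).
    apply pr_inj in E as [E <-]; apply pr_inj in E as [<- <-]; apply H; auto.
  - intros Pi; exists c, d, n; repeat split; auto; apply H; auto.
Qed.

Lemma inc_bound w : exists n, forall i, inc w i -> i < n.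
Proof.
  destruct (classic (exists c d n, w = pr (pr c d) n)) as [(c & d & n & ->)|N].
  - exists n; intros i (c' & d' & n' & E & Hi & _); apply pr_inj in E as [_ ->]; auto.
  - exists 0; intros i (c & d & n & E & _); destruct N; eauto.
Qed.

Lemma code_empty : exists w, forall i, ~ inc w i.
Proof.
  destruct (finite_code (fun _ => False) 0) as [w H]; [unfold ar1; ar_solve | tauto|].
  exists w; intros i; rewrite H; auto.
Qed.

Lemma code_adjoin w j : exists w', forall i, inc w' i <-> inc w i \/ i = j.
Proof.
  destruct (inc_bound w) as [n Hn].
  apply (finite_code (fun i => inc w i \/ i = j) (n + j + 1)); [unfold ar1; ar_solve|].
  intros i [H| ->].
  - eapply lt_trans; [apply Hn, H | apply lt_add_l].
  - apply lt_add_r.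
Qed.

(** ** Course-of-values recursion *)

Definition hist (w m v : M) : Prop := inc w (pr m v).

#[local] Instance ar_hist : ar3 hist.
Proof. ar_def hist. Qed.

Section Recursion.

Context (Phi : M -> (M -> M -> Prop) -> M -> M -> Prop).
Context {Phi_ar : ar4 (fun e w m v => Phi e (hist w) m v)}.
Context (Phi_local : forall e m (H H' : M -> M -> Prop),
  (forall a v, a < m -> (H a v <-> H' a v)) ->
  forall v, Phi e H m v -> Phi e H' m v).

(** [w] codes an initial segment of the recursion. [Phi] may admit several values; taking the least
    one makes the segment unique. *)
Definition good (e n w : M) : Prop :=
  (forall m v, hist w m v ->
     m < n /\ Phi e (hist w) m v /\ forall v', v' < v -> ~ Phi e (hist w) m v')
  /\ (forall m, m < n -> exists v, hist w m v).

#[local] Instance ar_good : ar3 good.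
Proof.
  ar_def good; apply (ar4_app (fun e w m v => Phi e (hist w) m v)); ar_solve.
Qed.

Lemma good_agree e n n' w w' :
  good e n w -> good e n' w' ->
  forall m, m < n -> m < n' -> forall v, hist w m v -> hist w' m v.
Proof.
  intros [G1 G2] [G1' G2'].
  assert (A : forall m, m < n -> m < n' -> forall v, hist w m v <-> hist w' m v).
  { intros m; pattern m; apply strong_induction; [unfold ar1; ar_solve|].
    clear m; intros m IH Hm Hm'.
    assert (L : forall v, Phi e (hist w) m v <-> Phi e (hist w') m v).
    { intros v; split; apply Phi_local; intros a u Ha;
        [|symmetry]; apply IH; eauto using lt_trans. }
    intros v; split; intros H.
    - destruct (G2' m Hm') as [v' H']; replace v with v'; auto.
      destruct (G1 _ _ H) as (_ & P1 & M1), (G1' _ _ H') as (_ & P1' & M1').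
      destruct (lt_trichotomy v' v) as [V|[V|V]]; auto; exfalso.
      + apply (M1 _ V), L, P1'.
      + apply (M1' _ V), L, P1.
    - destruct (G2 m Hm) as [v' H']; replace v with v'; auto.
      destruct (G1' _ _ H) as (_ & P1 & M1), (G1 _ _ H') as (_ & P1' & M1').
      destruct (lt_trichotomy v' v) as [V|[V|V]]; auto; exfalso.
      + apply (M1 _ V), L, P1'.
      + apply (M1' _ V), L, P1. }
  intros; apply A; auto.
Qed.

Lemma good_functional e n w m v v' : good e n w -> hist w m v -> hist w m v' -> v = v'.
Proof.
  intros [G _] (_ & P1 & M1)%G (_ & P1' & M1')%G.
  destruct (lt_trichotomy v v') as [V|[V|V]]; auto; exfalso.
  - apply (M1' _ V), P1.
  - apply (M1 _ V), P1'.
Qed.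

Definition rec (e m v : M) : Prop :=
  exists n w, m < n /\ good e n w /\ hist w m v.

#[local] Instance ar_rec : ar3 rec.
Proof. ar_def rec. Qed.

Lemma rec_good e n w m v : good e n w -> m < n -> (rec e m v <-> hist w m v).
Proof.
  intros G Hm; split; [|intros H; exists n, w; auto].
  intros (n' & w' & Hm' & G' & H); exact (good_agree _ _ _ _ _ G' G m Hm' Hm v H).
Qed.

Lemma rec_functional e m v v' : rec e m v -> rec e m v' -> v = v'.
Proof.
  intros (n & w & Hm & G & H); rewrite (rec_good _ _ _ _ _ G Hm).
  apply (good_functional _ _ _ _ _ _ G H).
Qed.

Lemma rec_Phi e m v : rec e m v -> Phi e (rec e) m v.
Proof.
  intros (n & w & Hm & G & H).
  refine (Phi_local _ _ (hist w) _ _ _ (proj1 (proj2 (proj1 G _ _ H)))).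
  intros a u Ha; rewrite (rec_good _ n w); eauto using lt_trans; tauto.
Qed.

(** A good [w] is extended one value at a time. The premise therefore asks for a value only over
    histories that arise this way, and may use what is known of them. *)
Lemma rec_total e :
  (forall m H, ar2 H ->
     (forall a v, H a v -> a < m /\ Phi e H a v) ->
     (forall a v v', H a v -> H a v' -> v = v') ->
     (forall a, a < m -> exists v, H a v) ->
     exists v, Phi e H m v) ->
  forall m, exists v, rec e m v.
Proof.
  intros E.
  assert (X : forall n, exists w, good e n w).
  { intros n; ind n.
    - destruct code_empty as [w Hw]; exists w; split.
      + intros m v H; destruct (Hw _ H).
      + intros m H; destruct (not_lt_0 _ H).
    - intros n [w G].
      destruct (least_number (fun v => Phi e (hist w) n v)) as (v & Pv & Mv).
      { apply (ar4_app (fun e w m v => Phi e (hist w) m v)); ar_solve. }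
      { apply E.
        - unfold ar2; ar_solve.
        - intros a v H; destruct (proj1 G _ _ H); tauto.
        - intros a v v'; apply (good_functional _ _ _ _ _ _ G).
        - apply G. }
      destruct (code_adjoin w (pr n v)) as [w' Hw']; exists w'.
      assert (K : forall m u, hist w' m u <-> hist w m u \/ m = n /\ u = v).
      { intros m u; unfold hist; rewrite Hw'; split; intros [H|H]; auto.
        - apply pr_inj in H; auto.
        - destruct H; subst; auto. }
      assert (L : forall m, m < n + 1 -> forall u,
                  Phi e (hist w) m u <-> Phi e (hist w') m u).
      { intros m Hm u; split; apply Phi_local; intros a u' Ha; rewrite K;
          (split; [|try tauto]); auto; intros [H|[-> _]]; auto;
          destruct (lt_irrefl n); apply lt_succ in Hm as [Hm| ->]; eauto using lt_trans. }
      split.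
      + intros m u [H|[-> ->]]%K.
        * destruct (proj1 G _ _ H) as (H1 & H2 & H3).
          assert (Hm : m < n + 1) by (apply lt_succ; auto).
          repeat split; auto; [apply L; auto|].
          intros v' V; rewrite <- L; auto.
        * assert (Hm : n < n + 1) by apply lt_succ_diag.
          repeat split; auto; [apply L; auto|].
          intros v' V; rewrite <- L; auto.
      + intros m [H| ->]%lt_succ.
        * destruct (proj2 G m H) as [u U]; exists u; apply K; auto.
        * exists v; apply K; auto. }
  intros m; destruct (X (m + 1)) as [w G].
  destruct (proj2 G m (lt_succ_diag m)) as [v V].
  exists v, (m + 1), w; auto using lt_succ_diag.
Qed.

End Recursion.

#[local] Existing Instance ar_rec.

(** ** The Gray code order of a separating sequence of sets *)

Section GrayOrder.

Context (X : M -> Prop) (C : M -> M -> Prop) {X_ar : ar1 X} {C_ar : ar2 C}.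
Context (C_sep : forall x y, X x -> X y -> x <> y -> exists e, ~ (C e x <-> C e y)).

(** The points agreeing with [x] at [n] form the cell of [x] at level [n]; a
    cell splits in at most two at the next level.  [mu n x] is its least
    element. *)
Definition agree (n x y : M) : Prop := forall e, e < n -> (C e x <-> C e y).

#[local] Instance ar_agree : ar3 agree.
Proof. ar_def agree. Qed.

Definition mu (n x m : M) : Prop :=
  X m /\ agree n x m /\ forall y, y < m -> X y -> ~ agree n x y.

#[local] Instance ar_mu : ar3 mu.
Proof. ar_def mu. Qed.

(** The least point changes between levels [n] and [n + 1] exactly when [x] lies in the half that
    does not contain it. *)
Definition chg (n x : M) : Prop := exists m, mu n x m /\ ~ (C n x <-> C n m).

#[local] Instance ar_chg : ar2 chg.
Proof. ar_def chg. Qed.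

(** Adds [chg k x] to the parity at [k]: [~ (p <-> q)] is exclusive or. *)
Definition parity_step (x : M) (H : M -> M -> Prop) (n v : M) : Prop :=
  (n = 0 /\ v = 0) \/
  exists k u, n = k + 1 /\ H k u /\ (v = 0 \/ v = 1) /\ (v = 1 <-> ~ (chg k x <-> u = 1)).

#[local] Instance ar_parity_step :
  ar4 (fun e w m v => parity_step e (hist w) m v).
Proof. ar_def parity_step. Qed.

Lemma parity_step_local x m (H H' : M -> M -> Prop) :
  (forall a v, a < m -> (H a v <-> H' a v)) ->
  forall v, parity_step x H m v -> parity_step x H' m v.
Proof.
  intros E v [P|(k & u & -> & P & Q)]; [left; auto | right].
  exists k, u; split; [auto|]; split; [apply E; auto using lt_succ_diag | auto].
Qed.

(** Parity of the number of [e < n] such that [chg e x]. *)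
Definition odd (n x : M) : Prop := rec parity_step x n 1.

#[local] Instance ar_odd : ar2 odd.
Proof. ar_def odd. Qed.

Lemma parity_total x n : exists v, rec parity_step x n v.
Proof.
  revert n; apply (rec_total parity_step parity_step_local).
  intros m H HH _ _ HT; destruct (zero_or_succ m) as [->|[k ->]].
  - exists 0; left; auto.
  - destruct (HT k (lt_succ_diag k)) as [u Hu].
    destruct (classic (chg k x <-> u = 1)) as [E|E].
    + exists 0; right; exists k, u; repeat split; auto; [|tauto].
      intros F; destruct (zero_neq_one F).
    + exists 1; right; exists k, u; repeat split; auto.
Qed.

Lemma odd_0 x : ~ odd 0 x.
Proof.
  intros H; apply (rec_Phi parity_step parity_step_local) in H.
  destruct H as [[_ E]|(k & u & E & _)]; [exact (zero_neq_one (eq_sym E))|].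
  exact (succ_neq_0 _ (eq_sym E)).
Qed.

Lemma odd_succ n x : odd (n + 1) x <-> ~ (chg n x <-> odd n x).
Proof.
  destruct (parity_total x (n + 1)) as [v Hv].
  assert (P := rec_Phi parity_step parity_step_local _ _ _ Hv).
  destruct P as [[E _]|(k & u & E & Hu & _ & P)]; [destruct (succ_neq_0 _ E)|].
  apply succ_inj in E; subst k.
  assert (F : forall m w, rec parity_step x m w -> (odd m x <-> w = 1)).
  { intros m w Hw; split; [|intros ->; auto].
    intros O; exact (rec_functional parity_step parity_step_local _ _ _ _ Hw O). }
  rewrite (F _ _ Hv), (F _ _ Hu); auto.
Qed.

Lemma agree_refl n x : agree n x x.
Proof. intros e _; tauto. Qed.

Lemma agree_sym n x y : agree n x y -> agree n y x.
Proof. intros H e He; rewrite (H e He); tauto. Qed.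

Lemma agree_trans n x y z : agree n x y -> agree n y z -> agree n x z.
Proof. intros H H' e He; rewrite (H e He); auto. Qed.

Lemma agree_mono n m x y : n < m + 1 -> agree m x y -> agree n x y.
Proof.
  intros [L| ->]%lt_succ H; auto; intros e He; apply H; eauto using lt_trans.
Qed.

Lemma agree_succ n x y : agree (n + 1) x y <-> agree n x y /\ (C n x <-> C n y).
Proof.
  split.
  - intros H; split; [|apply H, lt_succ_diag].
    intros e He; apply H, lt_succ; auto.
  - intros [H H'] e [L| ->]%lt_succ; auto.
Qed.

Lemma agree_0 x y : agree 0 x y.
Proof. intros e He; destruct (not_lt_0 _ He). Qed.

Lemma mu_exists n x : X x -> exists m, mu n x m.
Proof.
  intros Xx; destruct (least_number (fun m => X m /\ agree n x m)) as (m & [Xm A] & L).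
  - unfold ar1; ar_solve.
  - exists x; auto using agree_refl.
  - exists m; repeat split; try apply A; auto.
    intros y Hy Xy A'; apply (L y Hy); auto.
Qed.

Lemma mu_agree n x y m : agree n x y -> mu n x m -> mu n y m.
Proof.
  intros A (Xm & A' & L); split; [auto|]; split.
  - eauto using agree_sym, agree_trans.
  - intros z Hz Xz B; apply (L z Hz Xz); eauto using agree_trans.
Qed.

Lemma mu_unique n x m m' : mu n x m -> mu n x m' -> m = m'.
Proof.
  intros (H1 & H2 & H3) (H1' & H2' & H3').
  destruct (lt_trichotomy m m') as [L|[L|L]]; auto; exfalso.
  - apply (H3' _ L); auto.
  - apply (H3 _ L); auto.
Qed.

Lemma chg_mu n x m : mu n x m -> (chg n x <-> ~ (C n x <-> C n m)).
Proof.
  intros Hm; split; [|intros H; exists m; auto].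
  intros (m' & Hm' & H); rewrite (mu_unique _ _ _ _ Hm Hm'); auto.
Qed.

Lemma chg_agree n x y : agree (n + 1) x y -> chg n x -> chg n y.
Proof.
  intros [A E]%agree_succ (m & Hm & N); exists m; split; [eauto using mu_agree|tauto].
Qed.

Lemma odd_agree n x y : agree n x y -> (odd n x <-> odd n y).
Proof.
  ind n.
  - intros _; split; intros H; destruct (odd_0 _ H).
  - intros n IH A; rewrite !odd_succ, IH by (apply agree_succ in A; tauto).
    assert (E : chg n x <-> chg n y); [|tauto].
    split; apply chg_agree; auto using agree_sym.
Qed.

(** Exactly one of the two halves contains the least point of the cell, so the parity flips in
    exactly one of them. *)
Lemma odd_split n x y :
  X x -> agree n x y -> ~ (C n x <-> C n y) -> ~ (odd (n + 1) x <-> odd (n + 1) y).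
Proof.
  intros Xx A N; destruct (mu_exists n x Xx) as [m Hm].
  rewrite !odd_succ, (odd_agree n x y A), (chg_mu _ _ _ Hm).
  rewrite (chg_mu n y m) by eauto using mu_agree; tauto.
Qed.

Lemma odd_constant n m x :
  (forall k, n < k + 1 -> k < m -> ~ chg k x) -> n < m + 1 -> (odd m x <-> odd n x).
Proof.
  ind m.
  - intros _ [L| ->]%lt_succ; [destruct (not_lt_0 _ L) | tauto].
  - intros m IH H [L| ->]%lt_succ; [|tauto].
    rewrite odd_succ, IH; auto.
    + assert (~ chg m x) by (apply H; auto using lt_succ_diag); tauto.
    + intros k K K'; apply H; auto; apply lt_succ; auto.
Qed.

Lemma first_difference x y :
  X x -> X y -> x <> y -> exists n, agree n x y /\ ~ (C n x <-> C n y).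
Proof.
  intros Xx Xy N.
  destruct (least_number (fun n => ~ (C n x <-> C n y))) as (n & H & L).
  - unfold ar1; ar_solve.
  - apply C_sep; auto.
  - exists n; split; auto; intros e He; apply NNPP, L, He.
Qed.

Lemma difference_above k n x y : agree k x y -> ~ (C n x <-> C n y) -> k < n + 1.
Proof. intros A N; apply not_lt; intros L; apply N, A, L. Qed.

(** [lt False] is the order; [lt True] is its reverse, as the two halves of a
    split cell have opposite parities. *)
Definition lt (s : Prop) (x y : M) : Prop :=
  exists n, agree n x y /\ ~ (C n x <-> C n y) /\ (odd (n + 1) x <-> s).

#[local] Instance ar_lt_gray s : ar2 (lt s).
Proof. ar_def lt. Qed.

Lemma lt_gray_irrefl s x : ~ lt s x x.
Proof. intros (n & _ & N & _); tauto. Qed.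

Lemma lt_gray_trans s x y z : X x -> X y -> lt s x y -> lt s y z -> lt s x z.
Proof.
  intros Xx Xy (n & A & N & O) (m & A' & N' & O').
  destruct (lt_trichotomy n m) as [L|[<-|L]].
  - exists n; split; [|split; auto].
    + apply (agree_trans _ _ _ _ A), (agree_mono n m); auto.
      apply lt_succ; auto.
    + rewrite <- (A' n L); auto.
  (* At a common level, [x] and [y] would lie in opposite halves of equal parity. *)
  - destruct (odd_split n x y); auto; tauto.
  - exists m; split; [|split; auto].
    + apply (agree_trans _ _ y); auto; apply (agree_mono m n); auto.
      apply lt_succ; auto.
    + rewrite (A m L); auto.
    + rewrite <- O'; apply odd_agree, agree_succ; split; auto.
      apply (agree_mono m n); auto; apply lt_succ; auto.
Qed.

Lemma lt_gray_asym s x y : X x -> X y -> lt s x y -> ~ lt s y x.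
Proof.
  intros Xx Xy H H'; apply (lt_gray_irrefl s x), (lt_gray_trans s x y x); auto.
Qed.

Lemma lt_gray_total s x y : X x -> X y -> lt s x y \/ x = y \/ lt s y x.
Proof.
  intros Xx Xy; destruct (classic (x = y)) as [E|E]; auto.
  destruct (first_difference x y Xx Xy E) as (n & A & N).
  destruct (classic (odd (n + 1) x <-> s)) as [O|O].
  - left; exists n; auto.
  - right; right; exists n; split; [apply agree_sym, A|]; split; [tauto|].
    assert (D := odd_split n x y Xx A N); tauto.
Qed.

Lemma lt_gray_flip s t x y : X x -> ~ (s <-> t) -> lt s x y -> lt t y x.
Proof.
  intros Xx Hst (n & A & N & O); exists n; split; [apply agree_sym, A|].
  split; [tauto|]; assert (D := odd_split n x y Xx A N); tauto.
Qed.

Lemma lt_gray_agree_l s x x' y n :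
  agree (n + 1) x x' -> agree n x y -> ~ (C n x <-> C n y) -> (odd (n + 1) x <-> s) ->
  lt s x' y.
Proof.
  intros A A' N O; exists n; split; [|split].
  - apply agree_succ in A as [A _]; eauto using agree_sym, agree_trans.
  - apply agree_succ in A as [_ A]; tauto.
  - rewrite <- (odd_agree _ _ _ A); auto.
Qed.

(** The least point of a cell stays least in every smaller cell around it, so along [w] the parity
    is constant down to the level where [w] parts from [z]. *)
Lemma mu_extreme s n x w :
  mu n x w -> (odd n x <-> s) ->
  forall z, X z -> agree n x z -> z <> w -> lt s w z.
Proof.
  intros (Xw & A & L) O z Xz A' N.
  destruct (first_difference w z Xw Xz) as (m & D1 & D2); [auto|].
  assert (B : agree n w z) by eauto using agree_sym, agree_trans.
  assert (K := difference_above _ _ _ _ B D2).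
  exists m; split; [auto|]; split; [auto|].
  rewrite (odd_constant n (m + 1)).
  - rewrite <- (odd_agree _ _ _ A); auto.
  - intros k Hk _ (v & Hv & Nv).
    replace v with w in Nv by
      (apply (mu_unique k w); auto; split; [auto|]; split; [apply agree_refl|];
       intros y Hy Xy Ay; apply (L y Hy Xy), (agree_trans _ _ _ _ A), (agree_mono n k); auto).
    tauto.
  - apply lt_succ; auto.
Qed.

(** A first or last element of the cell of [x]: if the parity of the cell is
    right this is its least element, else the cell is a singleton or it
    splits and the half not containing its least element has the right
    parity. *)
Lemma cell_extreme s n x : X x ->
  exists w, X w /\ agree n x w /\
    forall z, X z -> agree n x z -> z <> w -> lt s w z.
Proof.
  intros Xx; destruct (classic (odd n x <-> s)) as [O|O].
  { destruct (mu_exists n x Xx) as [w Hw]; exists w.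
    split; [apply Hw|]; split; [apply Hw|].
    intros; apply (mu_extreme s n x); auto. }
  destruct (classic (forall z, X z -> agree n x z -> z = x)) as [E|E].
  { exists x; split; [auto|]; split; [apply agree_refl|].
    intros z Xz A N; destruct N; auto. }
  (* [m] is the first index whose set splits the cell. *)
  destruct (least_number (fun m => exists z, X z /\ agree n x z /\ ~ (C m x <-> C m z)))
    as (m & (z & Xz & Az & Nz) & L).
  { unfold ar1; ar_solve. }
  { apply NNPP; intros F; apply E; intros z Xz A; apply NNPP; intros N; apply F.
    destruct (first_difference x z Xx Xz) as (m & _ & Nm); [auto|].
    exists m, z; auto. }
  assert (B : forall y, X y -> agree n x y -> agree m x y).
  { intros y Xy A e He; apply NNPP; intros N; apply (L e He); eauto. }
  assert (Hnm := difference_above _ _ _ _ Az Nz).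
  (* The half of [v] misses the least point, so along [v] the parity flips at [m], for the first
     time since level [n]. *)
  assert (V : exists v, X v /\ agree n x v /\ chg m v).
  { destruct (mu_exists m x Xx) as [u Hu].
    destruct (classic (C m x <-> C m u)) as [F|F].
    - exists z; split; [auto|]; split; [auto|]; exists u; split; [|tauto].
      apply (mu_agree m x); auto.
    - exists x; split; [auto|]; split; [apply agree_refl|]; exists u; auto. }
  destruct V as (v & Xv & Av & Cv).
  assert (Ov : odd (m + 1) v <-> s).
  { rewrite odd_succ, (odd_constant n m v); auto.
    - rewrite <- (odd_agree n x v); auto; tauto.
    - intros k K K' (u & (Xu & Au & _) & Nu); apply Nu.
      assert (A : agree n x u) by (eapply agree_trans; [exact Av | eapply agree_mono; eauto]).
      rewrite <- (B v Xv Av k K'), <- (B u Xu A k K'); tauto. }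
  destruct (mu_exists (m + 1) v Xv) as [w Hw]; assert (Hw' := Hw).
  destruct Hw' as (Xw & Aw & _).
  assert (Aw' := proj1 (agree_succ _ _ _) Aw).
  assert (Axw : agree n x w).
  { apply (agree_trans _ _ _ _ Av), (agree_mono n m); [auto | apply Aw']. }
  exists w; split; [auto|]; split; [auto|].
  intros y Xy Ay N.
  assert (Awy : agree m w y) by (eapply agree_trans; [apply agree_sym|]; apply B; auto).
  (* Within its half, [w] is extreme as the least point; the points of the other half part from [w]
     at level [m] itself. *)
  destruct (classic (C m w <-> C m y)) as [F|F].
  - apply (mu_extreme s (m + 1) v); auto.
    apply (agree_trans _ _ _ _ Aw), agree_succ; auto.
  - exists m; split; [auto|]; split; [auto|].
    rewrite <- (odd_agree _ _ _ Aw); auto.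
Qed.

(** If [z] parted from [a] at a level [m] below [n], then [b], in the same half as [a] there, would
    lie on the same side of [z] as [a]. *)
Lemma cell_convex s n a z b :
  X a -> X z -> X b -> agree n a b -> lt s a z -> lt s z b -> agree n a z.
Proof.
  intros Xa Xz Xb A (m & A' & N & O) H.
  apply (agree_mono n m); auto; apply not_lt; intros L.
  apply (lt_gray_asym s z b); auto.
  apply (lt_gray_agree_l s a b z m); auto.
  apply (agree_mono _ n); auto.
  destruct (lt_trichotomy (m + 1) n) as [K|[->|K]];
    [apply lt_succ; auto | apply lt_succ_diag |].
  exfalso; apply lt_succ in K as [K| ->];
    [apply (lt_irrefl m); eauto using lt_trans | exact (lt_irrefl _ L)].
Qed.

(* The left end, for [s = False], or the right end, for [s = True], of an
   interval around [x] inside its cell. *)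
Lemma cell_bound s n x : X x ->
  (exists a, X a /\ lt s a x /\
     forall z, X z -> lt s a z -> lt s z x -> agree n x z)
  \/ (forall z, X z -> lt s z x -> agree n x z).
Proof.
  intros Xx; ind n; [right; intros; apply agree_0|].
  intros n IH.
  (* If no point of the sibling half precedes [x], the end found for level [n] still serves. *)
  assert (R : (forall z, X z -> lt s z x -> agree n x z -> agree (n + 1) x z) ->
    (exists a, X a /\ lt s a x /\
       forall z, X z -> lt s a z -> lt s z x -> agree (n + 1) x z)
    \/ (forall z, X z -> lt s z x -> agree (n + 1) x z)).
  { intros R; destruct IH as [(a & Xa & La & H)|H]; [left|right; auto].
    exists a; split; [auto|]; split; auto. }
  destruct (classic (exists z0, X z0 /\ agree n x z0 /\ ~ (C n x <-> C n z0)))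
    as [(z0 & X0 & A0 & N0)|E].
  2: { apply R; intros z Xz _ A; apply agree_succ; split; auto.
       apply NNPP; intros N; apply E; eauto. }
  destruct (classic (odd (n + 1) x <-> s)) as [O|O].
  { apply R; intros z Xz L A; apply agree_succ; split; auto.
    apply NNPP; intros N; apply (lt_gray_asym s z x); auto; exists n; auto. }
  clear R IH; left.
  assert (O0 := odd_split n x z0 Xx A0 N0).
  (* Here the sibling half precedes [x]. Its last point [w] for [lt s] is its first one for
     [lt (~ s)], and it bounds the new cell. *)
  destruct (cell_extreme (~ s) (n + 1) z0 X0) as (w & Xw & Aw & Ew).
  assert (Lw : lt s w x).
  { apply (lt_gray_agree_l s z0 w x n); auto; [apply agree_sym; auto | tauto | tauto]. }
  exists w; split; [auto|]; split; [auto|]; intros z Xz L1 L2.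
  assert (Awx : agree n w x).
  { apply agree_succ in Aw as [Aw _]; eauto using agree_sym, agree_trans. }
  assert (Az : agree n x z).
  { eapply agree_trans; [apply agree_sym, Awx|].
    apply (cell_convex s n w z x); auto. }
  apply agree_succ; split; auto; apply NNPP; intros N.
  assert (Bz : agree (n + 1) z0 z).
  { apply agree_succ; split; [eauto using agree_sym, agree_trans|].
    clear - N N0; tauto. }
  assert (Nw : z <> w) by (intros ->; exact (lt_gray_irrefl _ _ L1)).
  apply (lt_gray_asym s w z); auto.
  apply (lt_gray_flip (~ s) s); auto; tauto.
Qed.

(** A point stays on the same side of [a] as [x] while it agrees with [x] through the level where
    [a] and [x] part. *)
Lemma upper_ray_open s a x : lt s a x ->
  exists n, forall z, agree n x z -> lt s a z.
Proof.
  intros (n & A & N & O); exists (n + 1); intros z [B B']%agree_succ.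
  exists n; split; [eauto using agree_trans|]; split; [tauto | auto].
Qed.

Lemma lower_ray_open s x b : lt s x b ->
  exists n, forall z, agree n x z -> lt s z b.
Proof.
  intros (n & A & N & O); exists (n + 1); intros z B.
  apply (lt_gray_agree_l s x z b n); auto.
Qed.

End GrayOrder.

#[local] Existing Instances ar_agree ar_lt_gray.

(** ** Clopen bases of regular spaces *)

Section Space.

Context (X : M -> Prop) (U : M -> M -> Prop) {X_ar : ar1 X} {U_ar : ar2 U}.
Context (U_X : forall i x, U i x -> X x).
Context (U_cover : forall x, X x -> exists i, U i x).
Context (U_meet : forall x i j, U i x -> U j x ->
  exists n, U n x /\ forall y, U n y -> U i y /\ U j y).
(** T0 and regularity are put in terms of basic sets, so that only number quantifiers occur. *)
Context (U_T0 : forall x y, X x -> X y -> x <> y ->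
  exists i, U i x /\ ~ U i y \/ U i y /\ ~ U i x).
Context (U_regular : forall x i, U i x ->
  exists j, U j x /\
    forall y, X y -> ~ U i y -> exists m, U m y /\ forall z, ~ (U m z /\ U j z)).

Definition cl (j y : M) : Prop := X y /\ forall m, U m y -> exists z, U m z /\ U j z.

#[local] Instance ar_cl : ar2 cl.
Proof. ar_def cl. Qed.

Definition apart (i j : M) : Prop := forall y, ~ (cl i y /\ cl j y).

#[local] Instance ar_apart : ar2 apart.
Proof. ar_def apart. Qed.

Lemma apart_sym i j : apart i j -> apart j i.
Proof. intros H y [H1 H2]; apply (H y); auto. Qed.

Lemma U_cl j y : U j y -> cl j y.
Proof. intros H; split; eauto. Qed.

Lemma cl_mono i j : (forall y, U i y -> U j y) -> forall y, cl i y -> cl j y.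
Proof.
  intros H y [Xy Hy]; split; auto; intros m Hm.
  destruct (Hy m Hm) as (z & Hz & Hz'); eauto.
Qed.

Lemma not_cl j y : X y -> ~ cl j y -> exists m, U m y /\ forall z, ~ (U m z /\ U j z).
Proof.
  intros Xy N; apply NNPP; intros C; apply N; split; auto.
  intros m Hm; apply NNPP; intros C'; apply C; exists m; split; auto.
  intros z Hz; apply C'; eauto.
Qed.

Lemma regular_cl x i : U i x -> exists j, U j x /\ forall y, cl j y -> U i y.
Proof.
  intros H; destruct (U_regular x i H) as (j & Hj & R); exists j; split; auto.
  intros y [Xy Hy]; apply NNPP; intros N; destruct (R y Xy N) as (m & Hm & D).
  destruct (Hy m Hm) as [z Hz]; exact (D z Hz).
Qed.

(** If the basic set given by T0 contains [y] instead of [x], it is shrunk until its closure omits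
    [x]; a neighbourhood of [x] that misses the shrunk set keeps [y] out of its closure. *)
Lemma separate_point x y : X x -> X y -> x <> y -> exists i, U i x /\ ~ cl i y.
Proof.
  intros Xx Xy N; destruct (U_T0 x y Xx Xy N) as [i [[H1 H2]|[H1 H2]]].
  - destruct (regular_cl x i H1) as (j & Hj & R); exists j; auto.
  - destruct (regular_cl y i H1) as (j & Hj & R).
    destruct (not_cl j x Xx) as (m & Hm & D); [auto|].
    exists m; split; auto; intros [_ C].
    destruct (C j Hj) as (z & Z1 & Z2); apply (D z); auto.
Qed.

(** The neighbourhood is shrunk once for each earlier one on side [s], by induction inside the model
    since [m] may be nonstandard. *)
Lemma separate_finite (H : M -> M -> Prop) s y i m :
  ar2 H -> (forall a v v', H a v -> H a v' -> v = v') ->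
  (forall a j, a < m -> H a (pr s j) -> ~ cl j y) -> U i y ->
  exists j, U j y /\ (forall z, cl j z -> U i z) /\
    forall a k, a < m -> H a (pr s k) -> apart j k.
Proof.
  intros HH HF Hm Hi; revert Hm; ind m.
  - intros _; destruct (regular_cl y i Hi) as (j & Hj & R).
    exists j; repeat split; auto; intros a k L; destruct (not_lt_0 _ L).
  - intros m IH N; destruct IH as (j & Hj & R & A).
    { intros a k L; apply N, lt_succ; auto. }
    destruct (classic (exists k, H m (pr s k))) as [[k Hk]|C].
    + destruct (not_cl k y) as (n & Hn & D); [eauto | eauto using lt_succ_diag |].
      (* The open set [U n] misses [U k] and hence its closure, so a neighbourhood with closure
         inside [U n] is apart from [k]. *)
      destruct (regular_cl y n Hn) as (l & Hl & Rl).
      destruct (U_meet y j l Hj Hl) as (p & Hp & I).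
      exists p; split; [auto|]; split.
      { intros z Hz; apply R; revert z Hz; apply cl_mono, I. }
      intros a k' [L| ->]%lt_succ Hk' z [Z1 Z2].
      * apply (A a k' L Hk' z); split; auto; revert Z1; apply cl_mono, I.
      * replace k' with k in * by (eapply proj2, pr_inj, HF; eauto).
        destruct Z2 as [_ Z2]; destruct (Z2 n) as [z' D'].
        { apply Rl; revert Z1; apply cl_mono, I. }
        exact (D z' D').
    + exists j; repeat split; auto.
      intros a k [L| ->]%lt_succ Hk; [eauto | destruct C; eauto].
Qed.

(** Points of the space, in increasing order, receive a basic neighbourhood of
    index [j] and a side [s]; the neighbourhoods of opposite sides have
    disjoint closures, those of side [0] lie in [U i] and those of side [1]
    stay away from [x], where [e] codes [(x, i)].  So the points of side [0]
    form a clopen set between [x] and [U i]. *)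
Definition side_step (e : M) (H : M -> M -> Prop) (m v : M) : Prop :=
  exists x i s j, e = pr x i /\ v = pr s j /\
    (X m -> U j m /\ (s = 0 \/ s = 1)) /\
    (s = 0 -> (forall y, cl j y -> U i y) /\
       forall a k, a < m -> H a (pr 1 k) -> apart j k) /\
    (s = 1 -> ~ cl j x /\ forall a k, a < m -> H a (pr 0 k) -> apart j k).

#[local] Instance ar_side_step : ar4 (fun e w m v => side_step e (hist w) m v).
Proof. ar_def side_step. Qed.

Lemma side_step_local e m (H H' : M -> M -> Prop) :
  (forall a v, a < m -> (H a v <-> H' a v)) ->
  forall v, side_step e H m v -> side_step e H' m v.
Proof.
  intros E v (x & i & s & j & He & Hv & P1 & P2 & P3).
  exists x, i, s, j; repeat split; auto; try (apply P1; auto; fail);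
    try (apply P2; auto; fail); try (apply P3; auto; fail).
  - intros a k L K; apply (proj2 (P2 H0) a k L), E; auto.
  - intros a k L K; apply (proj2 (P3 H0) a k L), E; auto.
Qed.

Definition side : M -> M -> M -> Prop := rec side_step.

#[local] Instance ar_side : ar3 side.
Proof. unfold side; exact _. Qed.

(** A point joins side 0 if it lies in [U i] and outside the closures of the side 1 neighbourhoods
    so far, and side 1 otherwise. *)
Lemma side_total x i m : U i x -> exists v, side (pr x i) m v.
Proof.
  intros Hx; revert m; apply (rec_total side_step side_step_local).
  intros m H HH HP HF _.
  destruct (classic (X m)) as [Xm|Xm].
  (* A number outside the space gets the dummy side 2, on which no condition is imposed. *)
  2: { exists (pr (1 + 1) 0), x, i, (1 + 1), 0; split; [auto|]; split; [auto|].
       split; [tauto|]; split; intros E; [destruct (succ_neq_0 _ E)|].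
       destruct zero_neq_one; apply succ_inj; rewrite add_0_l; auto. }
  destruct (classic (U i m /\ forall a j, a < m -> H a (pr 1 j) -> ~ cl j m))
    as [[C1 C2]|C].
  - destruct (separate_finite H 1 m i m HH HF C2 C1) as (j & Hj & R & A).
    exists (pr 0 j), x, i, 0, j; split; [auto|]; split; [auto|].
    split; [auto|]; split; [auto|]; intros E; destruct (zero_neq_one E).
  (* A point in a side 0 closure lies in [U i], and in no side 1 closure because opposite
     neighbourhoods are apart; so it would have joined side 0. *)
  - assert (N : forall a j, a < m -> H a (pr 0 j) -> ~ cl j m).
    { intros a j L K Cm; apply C.
      destruct (HP _ _ K) as (_ & x' & i' & s & j' & E & E' & _ & P2 & P3).
      apply pr_inj in E as [<- <-]; apply pr_inj in E' as [<- <-].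
      split; [apply P2; auto|]; intros b k L' K' Ck.
      destruct (HP _ _ K') as (_ & x'' & i'' & s & k' & E & E' & _ & P2' & P3').
      apply pr_inj in E as [<- <-]; apply pr_inj in E' as [<- <-].
      destruct (lt_trichotomy a b) as [V|[<-|V]].
      - apply (proj2 (P3' eq_refl) a j V K m); auto.
      - destruct (pr_inj _ _ _ _ (HF _ _ _ K K')) as [E _]; exact (zero_neq_one E).
      - apply (proj2 (P2 eq_refl) b k V K' m); auto. }
    (* The centre [x] itself always joins side 0, because side 1 closures avoid it. *)
    assert (D : m <> x).
    { intros ->; apply C; split; auto; intros a j L K.
      destruct (HP _ _ K) as (_ & x' & i' & s & j' & E & E' & _ & _ & P3).
      apply pr_inj in E as [<- <-]; apply pr_inj in E' as [<- <-]; apply P3; auto. }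
    destruct (separate_point m x Xm (U_X _ _ Hx) D) as (n & Hn & Hn').
    destruct (separate_finite H 0 m n m HH HF N Hn) as (j & Hj & R & A).
    exists (pr 1 j), x, i, 1, j; split; [auto|]; split; [auto|].
    split; [auto|]; split; intros E; [destruct (zero_neq_one (eq_sym E))|].
    split; [intros Cx; apply Hn', U_cl, R, Cx | auto].
Qed.

Definition C (e y : M) : Prop :=
  exists x i, e = pr x i /\ U i x /\ X y /\ exists j, side e y (pr 0 j).

#[local] Instance ar_C : ar2 C.
Proof. ar_def C. Qed.

Lemma side_spec x i y v : X y -> side (pr x i) y v ->
  exists s j, v = pr s j /\ U j y /\ (s = 0 \/ s = 1) /\
    (s = 0 -> (forall z, cl j z -> U i z) /\
       forall a k, a < y -> side (pr x i) a (pr 1 k) -> apart j k) /\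
    (s = 1 -> ~ cl j x /\ forall a k, a < y -> side (pr x i) a (pr 0 k) -> apart j k).
Proof.
  intros Xy H; apply (rec_Phi side_step side_step_local) in H.
  destruct H as (x' & i' & s & j & E & -> & P1 & P2 & P3).
  apply pr_inj in E as [<- <-]; destruct (P1 Xy).
  exists s, j; auto.
Qed.

(** A point [z] in the neighbourhood chosen for [y] also lies in its own, so the two are not apart
    and [z] is on the side of [y]. *)
Lemma C_clopen e y : X y -> exists j, U j y /\ forall z, U j z -> (C e z <-> C e y).
Proof.
  intros Xy.
  destruct (classic (exists x i, e = pr x i /\ U i x)) as [(x & i & -> & Hx)|N].
  (* An index that codes no such pair gives the empty set, so any neighbourhood serves. *)
  2: { destruct (U_cover y Xy) as [j Hj]; exists j; split; auto.
       intros z Hz; split; intros (x & i & E & Hx & _); destruct N; eauto. }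
  destruct (side_total x i y Hx) as [v Hv].
  destruct (side_spec x i y v Xy Hv) as (s & j & -> & Hj & Hs & P2 & P3).
  exists j; split; auto; intros z Hz; assert (Xz := U_X _ _ Hz).
  destruct (side_total x i z Hx) as [v' Hv'].
  destruct (side_spec x i z v' Xz Hv') as (s' & j' & -> & Hj' & Hs' & P2' & P3').
  assert (NA : ~ apart j j') by (intros A; apply (A z); auto using U_cl).
  assert (E : s = s').
  { destruct Hs as [->| ->], Hs' as [->| ->]; auto; exfalso;
      (destruct (lt_trichotomy y z) as [V|[->|V]];
       [ apply NA, apart_sym; first [eapply (proj2 (P3' eq_refl)) | eapply (proj2 (P2' eq_refl))]; eauto
       | apply zero_neq_one;
         destruct (pr_inj _ _ _ _ (rec_functional _ side_step_local _ _ _ _ Hv Hv')); auto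
       | apply NA; first [eapply (proj2 (P3 eq_refl)) | eapply (proj2 (P2 eq_refl))]; eauto ]). }
  subst s'.
  assert (K : forall u k, X u -> side (pr x i) u (pr s k) -> (C (pr x i) u <-> s = 0)).
  { intros u k Xu Hu; split.
    - intros (_ & _ & _ & _ & _ & l & Hl).
      destruct (pr_inj _ _ _ _ (rec_functional _ side_step_local _ _ _ _ Hu Hl)); auto.
    - intros ->; exists x, i; eauto 6. }
  rewrite (K z j'), (K y j); auto; tauto.
Qed.

(** With the index coding [y] and [i], the point [y] cannot be on side 1, whose closures avoid it,
    and side 0 stays inside [U i]. *)
Lemma C_base i y : U i y -> exists e, C e y /\ forall z, C e z -> U i z.
Proof.
  intros H; assert (Xy := U_X _ _ H); exists (pr y i).
  split.
  - destruct (side_total y i y H) as [v Hv].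
    destruct (side_spec y i y v Xy Hv) as (s & j & -> & Hj & [->| ->] & _ & P3).
    + exists y, i; eauto 6.
    + destruct (proj1 (P3 eq_refl)); apply U_cl, Hj.
  - intros z (_ & _ & _ & _ & Xz & j & Hj).
    destruct (side_spec y i z _ Xz Hj) as (s & k & E & Hk & _ & P2 & _).
    apply pr_inj in E as [<- <-]; apply P2, U_cl; auto.
Qed.

Lemma C_separates x y : X x -> X y -> x <> y -> exists e, ~ (C e x <-> C e y).
Proof.
  intros Xx Xy N; destruct (U_T0 x y Xx Xy N) as [i [[H1 H2]|[H1 H2]]];
    destruct (C_base _ _ H1) as (e & He & Hi); exists e; intros E; apply H2, Hi, E, He.
Qed.

Lemma cell_open n l : X l -> exists j, U j l /\ forall z, U j z -> agree C n l z.
Proof.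
  intros Xl; ind n.
  - destruct (U_cover l Xl) as [j Hj]; exists j; split; auto using agree_0.
  - intros n (j & Hj & A); destruct (C_clopen n l Xl) as (k & Hk & B).
    destruct (U_meet l j k Hj Hk) as (p & Hp & I); exists p; split; auto.
    intros z Hz; apply agree_succ; split; [apply A, I, Hz|].
    symmetry; apply B, I, Hz.
Qed.

(** * Comparison of the order topology with the given one *)

Notation below := (lt X C False).

Context (R : M -> M -> Prop) (R_spec : forall a b, R a b <-> X a /\ X b /\ below a b).

(** [0], [1] and [l + 1 + 1] stand for the lower end, the upper end and [l]. *)
Definition end_of (a : M) : Prop := a = 0 \/ a = 1 \/ exists l, X l /\ a = l + 1 + 1.

Definition end_lt (a b : M) : Prop :=
  (a = 0 /\ ~ b = 0) \/ (~ a = 1 /\ b = 1) \/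
  exists l m, a = l + 1 + 1 /\ b = m + 1 + 1 /\ R l m.

Lemma emb_neq_1 l : l + 1 + 1 <> 1.
Proof.
  intros E; apply (succ_neq_0 l), succ_inj; rewrite add_0_l; auto.
Qed.

Lemma emb_inj l m : l + 1 + 1 = m + 1 + 1 -> l = m.
Proof. intros E; apply succ_inj, succ_inj, E. Qed.

Lemma end_lt_emb l m : end_lt (l + 1 + 1) (m + 1 + 1) <-> R l m.
Proof.
  split.
  - intros [[E _]|[[_ E]|(l' & m' & E & E' & H)]].
    + destruct (succ_neq_0 _ E).
    + destruct (emb_neq_1 _ E).
    + apply emb_inj in E, E'; subst; auto.
  - intros H; right; right; exists l, m; auto.
Qed.

Lemma end_lt_upper_open a l : X l -> end_lt a (l + 1 + 1) ->
  exists i, U i l /\ forall z, U i z -> end_lt a (z + 1 + 1).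
Proof.
  intros Xl [[E _]|[[_ E]|(b & m & -> & E & H)]].
  - destruct (U_cover l Xl) as [i Hi]; exists i; split; auto.
    intros z _; left; split; auto using succ_neq_0.
  - destruct (emb_neq_1 _ E).
  - apply emb_inj in E; subst m; apply R_spec in H as (Xb & _ & H).
    destruct (upper_ray_open X C False b l H) as [n Hn].
    destruct (cell_open n l Xl) as (i & Hi & A); exists i; split; auto.
    intros z Hz; apply end_lt_emb, R_spec; repeat split;
      [auto | exact (U_X _ _ Hz) | apply Hn, A, Hz].
Qed.

Lemma end_lt_lower_open l b : X l -> end_lt (l + 1 + 1) b ->
  exists i, U i l /\ forall z, U i z -> end_lt (z + 1 + 1) b.
Proof.
  intros Xl [[E _]|[[_ E]|(m & c & E & -> & H)]].
  - destruct (succ_neq_0 _ E).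
  - destruct (U_cover l Xl) as [i Hi]; exists i; split; auto.
    intros z _; right; left; split; auto using emb_neq_1.
  - apply emb_inj in E; subst m; apply R_spec in H as (_ & Xc & H).
    destruct (lower_ray_open X C False l c H) as [n Hn].
    destruct (cell_open n l Xl) as (i & Hi & A); exists i; split; auto.
    intros z Hz; apply end_lt_emb, R_spec; repeat split;
      [exact (U_X _ _ Hz) | auto | apply Hn, A, Hz].
Qed.

Lemma interval_open a b l : X l -> end_lt a (l + 1 + 1) -> end_lt (l + 1 + 1) b ->
  exists i, U i l /\
    forall z, U i z -> X z /\ end_lt a (z + 1 + 1) /\ end_lt (z + 1 + 1) b.
Proof.
  intros Xl Ha Hb.
  destruct (end_lt_upper_open a l Xl Ha) as (i & Hi & A).
  destruct (end_lt_lower_open l b Xl Hb) as (j & Hj & B).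
  destruct (U_meet l i j Hi Hj) as (k & Hk & I); exists k; split; auto.
  intros z Hz; destruct (I z Hz) as [Hi' Hj']; split; [exact (U_X _ _ Hz) | auto].
Qed.

Lemma cell_left_end n y : X y ->
  exists a, end_of a /\ end_lt a (y + 1 + 1) /\
    forall z, X z -> end_lt a (z + 1 + 1) -> below z y -> agree C n y z.
Proof.
  intros Xy; destruct (cell_bound X C C_separates False n y Xy) as [(a & Xa & La & H)|H].
  - exists (a + 1 + 1); split; [right; right; eauto|].
    split; [apply end_lt_emb, R_spec; auto|].
    intros z Xz Lz; apply end_lt_emb, R_spec in Lz as (_ & _ & Lz); auto.
  - exists 0; split; [left; auto|].
    split; [left; auto using succ_neq_0 | auto].
Qed.

Lemma cell_right_end n y : X y ->
  exists b, end_of b /\ end_lt (y + 1 + 1) b /\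
    forall z, X z -> end_lt (z + 1 + 1) b -> below y z -> agree C n y z.
Proof.
  assert (FT : forall u v, X u -> below u v -> lt X C True v u).
  { intros u v Xu; apply (lt_gray_flip X C False True); auto; tauto. }
  assert (TF : forall u v, X u -> lt X C True u v -> below v u).
  { intros u v Xu; apply (lt_gray_flip X C True False); auto; tauto. }
  intros Xy; destruct (cell_bound X C C_separates True n y Xy) as [(b & Xb & Lb & H)|H].
  - exists (b + 1 + 1); split; [right; right; eauto|].
    split; [apply end_lt_emb, R_spec; auto|].
    intros z Xz Lz; apply end_lt_emb, R_spec in Lz as (_ & _ & Lz); auto.
  - exists 1; split; [right; left; auto|].
    split; [right; left; auto using emb_neq_1 | auto].
Qed.

Lemma open_interval j y : U j y ->
  exists a b, end_of a /\ end_of b /\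
    end_lt a (y + 1 + 1) /\ end_lt (y + 1 + 1) b /\
    forall z, X z -> end_lt a (z + 1 + 1) -> end_lt (z + 1 + 1) b -> U j z.
Proof.
  intros Hy; assert (Xy := U_X _ _ Hy).
  destruct (C_base j y Hy) as (e & He & HC).
  (* Agreement at level [e + 1] includes the set [C e], so this cell of [y] lies inside [U j]. *)
  destruct (cell_left_end (e + 1) y Xy) as (a & Ea & La & Ha).
  destruct (cell_right_end (e + 1) y Xy) as (b & Eb & Lb & Hb).
  exists a, b; do 4 (split; [assumption|]); intros z Xz Az Bz; apply HC.
  assert (A : agree C (e + 1) y z).
  { destruct (lt_gray_total X C C_separates False z y Xz Xy) as [L|[->|L]];
      auto using agree_refl. }
  apply (A e (lt_succ_diag e)), He.
Qed.

End Space.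

#[local] Existing Instance ar_C.

(** * The theorem in a model and its derivability *)

Definition end_max (R : M -> M -> Prop) (a b c : M) : Prop :=
  (end_lt R a b /\ c = b) \/ (~ end_lt R a b /\ c = a).

Definition end_min (R : M -> M -> Prop) (a b c : M) : Prop :=
  (end_lt R a b /\ c = a) \/ (~ end_lt R a b /\ c = b).

(** The order is placed on [X] itself, and the homeomorphism is the identity. *)
Theorem T3_orderable r q :
  holds S r q (close (∀² X U k, (CSC X U k ∧ T3 X U) ⇒
       ∃² L R V h, linear_order L R ∧ order_topology L R V h
                   ∧ homeomorphic X U L V)).
Proof.
  cbn; intros X U k [(H1 & H2 & _ & _ & H5) [HT0 Hreg]].
  set (x := fun a => smem S a X) in *.
  pose (u := fun i a => smem S (pr i a) U).
  assert (x_ar : ar1 x) by (unfold ar1, x; ar_solve).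
  assert (u_ar : ar2 u) by (unfold ar2, u; ar_solve).
  assert (u_x : forall i a, u i a -> x a) by exact H1.
  assert (u_cover : forall a, x a -> exists i, u i a) by exact H2.
  assert (u_meet : forall a i j, u i a -> u j a ->
    exists n, u n a /\ forall b, u n b -> u i b /\ u j b).
  { intros a i j Hi Hj; destruct (H5 a i j Hi Hj) as (n & _ & H); exists n; exact H. }
  assert (u_T0 : forall a b, x a -> x b -> a <> b ->
    exists i, u i a /\ ~ u i b \/ u i b /\ ~ u i a).
  (* [holds] reads an implication with a negated premise as a disjunction, whence the case [E]. *)
  { intros a b Xa Xb N; destruct (HT0 a b Xa Xb) as [E|(A & [_ HA] & [[Ha Hb]|[Ha Hb]])].
    - destruct (N E).
    - destruct (HA a Ha) as (i & Hi & I); exists i; left; split; [exact Hi|].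
      intros Hib; apply Hb, I, Hib.
    - destruct (HA b Hb) as (i & Hi & I); exists i; right; split; [exact Hi|].
      intros Hib; apply Ha, I, Hib. }
  assert (u_regular : forall a i, u i a -> exists j, u j a /\
    forall b, x b -> ~ u i b -> exists m, u m b /\ forall c, ~ (u m c /\ u j c)).
  (* A basic [U j] around [a] inside [V] works: a point off [U i] lies in [W], which is open and
     disjoint from [V]. *)
  { intros a i Hi; destruct (Hreg a i Hi) as (V & W & [_ HV] & [_ HW] & Va & D & I).
    destruct (HV a Va) as (j & Hj & J); exists j; split; [exact Hj|].
    intros b Xb Nb.
    assert (Wb : smem S b W) by (apply NNPP; intros N; apply Nb, I; auto).
    destruct (HW b Wb) as (m & Hm & Im); exists m; split; [exact Hm|].
    intros c [Hc1 Hc2]; destruct (D c (J c Hc2)) as [_ N]; apply N, Im, Hc1. }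
  pose (below := lt x (C x u) False).
  destruct (comprehension
    (fun z => exists a b, x a /\ x b /\ below a b /\ z = pr a b)) as [R HR].
  { unfold ar1, below; ar_solve. }
  pose (R' := fun a b => smem S (pr a b) R).
  assert (R_spec : forall a b, R' a b <-> x a /\ x b /\ below a b).
  { intros a b; unfold R'; rewrite HR; split.
    - intros (a' & b' & Xa & Xb & L & E); apply pr_inj in E as [-> ->]; auto.
    - intros (Xa & Xb & L); exists a, b; auto. }
  assert (R'_ar : ar2 R') by (unfold ar2, R'; ar_solve).
  assert (end_ar : ar1 (end_of x)) by ar_def end_of.
  assert (end_lt_ar : ar2 (end_lt R')) by ar_def end_lt.
  assert (end_max_ar : ar3 (end_max R')) by ar_def end_max.
  assert (end_min_ar : ar3 (end_min R')) by ar_def end_min.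
  destruct (comprehension (fun z => exists a b l, end_of x a /\ end_of x b /\ x l /\
    end_lt R' a (l + 1 + 1) /\ end_lt R' (l + 1 + 1) b /\ z = pr (pr a b) l)) as [V HV].
  { unfold ar1; ar_solve. }
  destruct (comprehension (fun w => exists z a b y1 y2 c d, x z /\
    end_of x a /\ end_of x b /\ end_of x y1 /\ end_of x y2 /\
    end_max R' a y1 c /\ end_min R' b y2 d /\
    w = pr (pr (pr z (pr a b)) (pr y1 y2)) (pr c d))) as [h Hh].
  { unfold ar1; ar_solve. }
  destruct (comprehension (fun z => exists a, x a /\ z = pr a a)) as [f Hf].
  { unfold ar1; ar_solve. }
  assert (f_spec : forall a b, smem S (pr a b) f <-> x a /\ a = b).
  { intros a b; rewrite Hf; split.
    - intros (c & Xc & E); apply pr_inj in E as [-> ->]; auto.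
    - intros [Xa <-]; eauto. }
  (* The sets [V] and [h] were comprehended so that [HV] and [Hh] are, by conversion, the two halves
     of [order_topology]. *)
  exists X, R, V, h; split; [|split; [exact (conj HV Hh)|]].
  - split; [|split; [|split]].
    + intros z Hz; apply HR in Hz as (a & b & Xa & Xb & _ & ->); exists a, b; auto.
    + intros a Ha; apply R_spec in Ha as (_ & _ & Ha); exact (lt_gray_irrefl _ _ _ _ Ha).
    + intros a b c Hab Hbc; apply R_spec in Hab as (Xa & Xb & Hab).
      apply R_spec in Hbc as (_ & Xc & Hbc); apply R_spec; split; [auto|]; split; [auto|].
      exact (lt_gray_trans _ _ _ _ _ _ Xa Xb Hab Hbc).
    + intros a b Xa Xb.
      destruct (lt_gray_total x (C x u) (C_separates x u u_x u_meet u_T0 u_regular)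
                  False a b Xa Xb) as [L|[L|L]]; [left|right; left; exact L|right; right];
        apply R_spec; auto.
  - exists f, f; split; [|split; [|split; [|split]]].
    + split; [|split].
      * split; [|split].
        -- intros z Hz; apply Hf in Hz as (a & Xa & ->); exists a, a; auto.
        -- intros a Xa; exists a; apply f_spec; auto.
        -- intros a b c Hb Hc; apply f_spec in Hb as [_ <-]; apply f_spec in Hc as [_ <-]; auto.
      * intros a b c Ha Hb; apply f_spec in Ha as [_ ->]; apply f_spec in Hb as [_ ->]; auto.
      * intros b Xb; exists b; apply f_spec; auto.
    + split; [|split].
      * intros z Hz; apply Hf in Hz as (a & Xa & ->); exists a, a; auto.
      * intros a Xa; exists a; apply f_spec; auto.
      * intros a b c Hb Hc; apply f_spec in Hb as [_ <-]; apply f_spec in Hc as [_ <-]; auto.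
    + intros a b; split; intros H; apply f_spec in H as [Xa <-]; apply f_spec; auto.
    + intros a a' j Ha Hj; apply f_spec in Ha as [_ <-].
      apply HV in Hj as (c & d & l & Ec & Ed & Xl & Lc & Ld & E).
      apply pr_inj in E as [-> <-].
      destruct (interval_open x u u_x u_cover u_meet u_T0 u_regular R' R_spec c d a Xl Lc Ld)
        as (i & Hi & I).
      exists i; split; [exact Hi|]; intros v w Hv Hw; apply f_spec in Hw as [_ <-].
      destruct (I v Hv) as (Xv & Cv & Dv); apply HV; exists c, d, v; auto 8.
    + intros a a' j Ha Hj; apply f_spec in Ha as [Xa <-].
      destruct (open_interval x u u_x u_meet u_T0 u_regular R' R_spec j a Hj)
        as (c & d & Ec & Ed & Lc & Ld & I).
      exists (pr c d); split; [apply HV; exists c, d, a; auto 8|].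
      intros v w Hv Hw; apply f_spec in Hw as [Xv <-].
      apply HV in Hv as (c' & d' & l & _ & _ & _ & Cv & Dv & E).
      apply pr_inj in E as [E <-]; apply pr_inj in E as [<- <-].
      apply I; auto.
Qed.

End Model.

Theorem theorem7p3 :
  proves ACA0 (close
    (∀² X U k, (CSC X U k ∧ T3 X U) ⇒
       ∃² L R V h, linear_order L R ∧ order_topology L R V h
                   ∧ homeomorphic X U L V)).
Proof.
  apply completeness; [apply ACA0_subst|].
  intros S HS r q; apply holds_sat, (T3_orderable S q HS).
Qed.
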